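(* (i) Let $1<p<\infty$ and let $(e_n)_n$ be a nontrivial spreading model of order $\xi$ of $\ell^p$, for some $1\le\xi<\omega_1$. Then: (a) if $(e_n)_n$ is normalized and Schauder basic, then it is isometric to the usual basis of $\ell^p$; (b) if $(e_n)_n$ is singular, then the space it generates is isometric to $\ell^p$. (ii) Every nontrivial spreading model of any order of $\ell^1$ is Schauder basic and equivalent to the usual basis of $\ell^1$. (iii) For all $1\le p<\infty$ and every $(e_n)_{n}\in\mathcal{SM}(\ell^p)=\bigcup_{1\le\xi<\omega_1}\mathcal{SM}_\xi(\ell^p)$ there exists a sequence $(u_n)_n$ in $\ell^p$ isometric to $(e_n)_n$.
   Context: $\mathbb{N}=\{1,2,\dots\}$. For $M\subseteq\mathbb{N}$ infinite, $M(k)$ is its $k$-th element; for a finite set $s$, $s(k)$ is its $k$-th element; $t\sqsubseteq s$ means initial segment. For a family $\mathcal{F}$ of finite subsets of $\mathbb{N}$ let $\widehat{\mathcal{F}}=\{t:\exists s\in\mathcal{F},\ t\sqsubseteq s\}$ and $\mathcal{F}\upharpoonright M=\{s\in\mathcal{F}:s\subseteq M\}$. $\mathcal{F}$ is thin if no element is a proper initial segment of another. A family is regular if it is hereditary (closed under subsets), spreading (if $\{n_1<\dots<n_k\}$ is in it, $m_1<\dots<m_k$, $n_i\le m_i$ for all $i$, then $\{m_1,\dots,m_k\}$ is in it) and compact (its characteristic functions form a closed subset of $\{0,1\}^{\mathbb{N}}$). $\mathcal{F}$ is regular thin if it is thin and $\widehat{\mathcal{F}}$ is regular. The order $o(\mathcal{F})$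 is the (countable) rank of the well-founded tree $\widehat{\mathcal{F}}$: maximal elements have rank $0$, the rank of $s$ is $\sup\{\mathrm{rank}(t)+1: t\in\widehat{\mathcal{F}},\ s\sqsubset t\}$, and $o(\mathcal{F})$ is the rank of $\emptyset$. A tuple $(s_1,\dots,s_l)$ of nonempty finite subsets of $\mathbb{N}$ is plegma if $s_i(k)<s_j(k)$ whenever $i<j$ and $k\le\min(|s_i|,|s_j|)$, and $s_i(k)<s_j(k+1)$ for all $i,j$ and $k\le\min(|s_i|,|s_j|-1)$. An $\mathcal{F}$-subsequence $(x_s)_{s\in\mathcal{F}\upharpoonright M}$ in a Banach space $X$ ($M\subseteq\mathbb{N}$ infinite) is a map $s\mapsto x_s$ from $\mathcal{F}\upharpoonright M$ to $X$. Let $(e_n)_n$ be a Hamel basis of an infinite-dimensional seminormed space with seminorm $\|\cdot\|_*$. $(x_s)_{s\in\mathcal{F}\upharpoonright M}$ generates $(e_n)_n$ as an $\mathcal{F}$-spreading model if there is a null sequence $(\delta_n)_n$ of positive reals such that $\big|\,\|\sum_{j=1}^k a_jx_{s_j}\|-\|\sum_{j=1}^k a_je_j\|_*\big|\le\delta_l$ for all $1\le k\le l$, all plegma $k$-tuples $(s_j)_{j=1}^k$ in $\mathcal{F}\upharpoonright M$ with $s_1(1)\ge M(l)$ and all $a_1,\dots,a_k\in[-1,1]$. For $1\le\xi<\omega_1$, $(e_n)_n$ is a spreading model of order $\xi$ ($\xi$-spreading model) of $X$, written $(e_n)_n\in\mathcal{SM}_\xi(X)$, if it is generated by some $\mathcal{F}$-subsequence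 in $X$ with $\mathcal{F}$ regular thin and $o(\mathcal{F})=\xi$. $(e_n)_n$ is trivial if $\|\cdot\|_*$ is not a norm on its span. For nontrivial $(e_n)_n$, the space it generates is the completion $E$ of its span; $(e_n)_n$ is Schauder basic if it is a Schauder basis of $E$, and singular if it is nontrivial but not Schauder basic. Normalized means $\|e_n\|_*=1$ for all $n$. Sequences $(u_n),(v_n)$ are isometric if $\|\sum_{j\le n} a_ju_j\|=\|\sum_{j\le n} a_jv_j\|$ for all $n$ and all reals $a_j$, and equivalent if these (semi)norms are comparable up to fixed positive constants. *)

(* Defs.v *)
From HB Require Import structures.
From mathcomp Require Import all_boot all_order all_algebra finmap.
From mathcomp Require Import ring_quotient generic_quotient ring lra.
From mathcomp Require Import all_classical all_reals all_analysis.

Set Implicit Arguments.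
Unset Strict Implicit.
Unset Printing Implicit Defensive.
Import Order.TTheory GRing.Theory Num.Theory.
Import numFieldNormedType.Exports.
Local Open Scope classical_set_scope.
Local Open Scope ring_scope.

(* The set of positive integers is represented by nat, and all indices (of
   elements of sets, of sequences, of coordinates) start at 0.  Only the order
   of the index set matters below, so this is a mere renumbering. *)

Definition family := set {fset nat}.

Definition elts (s : {fset nat}) : seq nat := sort leq s.

(* The element of s of rank k, counted from 0; a junk value if #|` s | <= k. *)
Definition el (s : {fset nat}) (k : nat) : nat := nth 0%N (elts s) k.

Definition initial (t s : {fset nat}) : bool := prefix (elts t) (elts s).

Definition proper_initial (t s : {fset nat}) : bool := initial t s && (t != s).

Definition closure_initial (F : family) : family :=
  [set t | exists2 s, F s & initial t s].

Definition thin (F : family) : Prop :=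
  forall s t, F s -> F t -> ~~ proper_initial s t.

Definition hereditary_family (F : family) : Prop :=
  forall s t : {fset nat}, F s -> (t `<=` s)%fset -> F t.

Definition spreading (F : family) : Prop :=
  forall s t : {fset nat}, F s -> #|` t | = #|` s | ->
    (forall k, (k < #|` s |)%N -> (el s k <= el t k)%N) -> F t.

Definition indicator (s : {fset nat}) : cantor_space := fun n => n \in s.

Definition compact_family (F : family) : Prop := closed (indicator @` F).

Definition regular (F : family) : Prop :=
  [/\ hereditary_family F, spreading F & compact_family F].

Definition regular_thin (F : family) : Prop :=
  thin F /\ regular (closure_initial F).

(* Countable ordinals: ssup f denotes the least ordinal greater than all f n.
   Every ordinal below omega_1 is denoted, by many terms, so ordinals are
   compared with cord_eq. *)
Inductive cord : Type := cord0 | ssup of (nat -> cord).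

Fixpoint cord_le (a b : cord) : Prop :=
  match a, b with
  | cord0, _ => True
  | ssup _, cord0 => False
  | ssup f, ssup g => forall n, exists m, cord_le (f n) (g m)
  end.

Definition cord_lt (a b : cord) : Prop :=
  if b is ssup g then exists m, cord_le a (g m) else False.

Definition cord_eq (a b : cord) : Prop := cord_le a b /\ cord_le b a.

Definition cord1 : cord := ssup (fun=> cord0).

Lemma cord_le_refl a : cord_le a a.
Proof. by elim: a => //= f IH n; exists n. Qed.

Lemma cord_le_trans a b c : cord_le a b -> cord_le b c -> cord_le a c.
Proof.
elim: a b c => [//|f IH] [//|g] [//|h] /= fg gh n.
have [m fgm] := fg n; have [k ghk] := gh m.
by exists k; exact: IH fgm ghk.
Qed.

Lemma cord_lt_le_trans a b c : cord_lt a b -> cord_le b c -> cord_lt a c.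
Proof.
case: b c => [//|g] [//|h] /= [m agm] gh; have [k ghk] := gh m.
by exists k; exact: cord_le_trans agm ghk.
Qed.

Lemma ssupP f a : cord_le (ssup f) a <-> forall n, cord_lt (f n) a.
Proof. by case: a => [|g] //=; split=> [//|/(_ 0%N)]. Qed.

(* rk s is the supremum of rk t + 1 over the proper end-extensions t of s in
   the tree. *)
Definition is_tree_rank (T : family) (rk : {fset nat} -> cord) : Prop :=
  forall s, T s ->
    (forall t, T t -> proper_initial s t -> cord_lt (rk t) (rk s)) /\
    (forall a, (forall t, T t -> proper_initial s t -> cord_lt (rk t) a) ->
       cord_le (rk s) a).

(* The membership of the empty set excludes the empty family, whose tree has
   no root. *)
Definition has_order (F : family) (xi : cord) : Prop :=
  closure_initial F fset0 /\
  exists rk, is_tree_rank (closure_initial F) rk /\ cord_eq (rk fset0) xi.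

Definition plegma (l : nat) (s : 'I_l -> {fset nat}) : Prop :=
  [/\ forall i, s i != fset0,
      forall (i j : 'I_l) k, (i < j)%N ->
        (k < #|` s i |)%N -> (k < #|` s j |)%N -> (el (s i) k < el (s j) k)%N
    & forall (i j : 'I_l) k,
        (k < #|` s i |)%N -> (k.+1 < #|` s j |)%N ->
        (el (s i) k < el (s j) k.+1)%N].

Record seminorm (R : realType) (V : lmodType R) := Seminorm {
  seminorm_fun :> V -> R;
  seminormD : forall x y, seminorm_fun (x + y) <= seminorm_fun x + seminorm_fun y;
  seminormZ : forall (a : R) x, seminorm_fun (a *: x) = `|a| * seminorm_fun x
}.

Section seminorm_theory.
Context (R : realType) (V : lmodType R) (nu : seminorm V).

Lemma seminorm0 : nu 0 = 0.
Proof. by rewrite -(scale0r 0) seminormZ normr0 mul0r. Qed.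

Lemma seminormN x : nu (- x) = nu x.
Proof. by rewrite -scaleN1r seminormZ normrN1 mul1r. Qed.

Lemma seminorm_ge0 x : 0 <= nu x.
Proof.
have := seminormD nu x (- x); rewrite subrr seminorm0 seminormN => h; lra.
Qed.

Lemma seminorm_distC x y : nu (x - y) = nu (y - x).
Proof. by rewrite -seminormN opprB. Qed.

Lemma seminorm_dist x y : `|nu x - nu y| <= nu (x - y).
Proof.
have := seminormD nu (x - y) y; rewrite subrK => h1.
have := seminormD nu (y - x) x; rewrite subrK seminorm_distC => h2.
by rewrite ler_norml; apply/andP; split; lra.
Qed.

Lemma seminorm_sub_trans z x y : nu (x - y) <= nu (x - z) + nu (z - y).
Proof. by have := seminormD nu (x - z) (z - y); rewrite addrA subrK. Qed.

End seminorm_theory.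

Section completion.
Context (R : realType) (V : lmodType R) (nu : seminorm V).

Definition cauchy_seq (u : nat -> V) := forall e : R, 0 < e ->
  exists N, forall m n, (N <= m)%N -> (N <= n)%N -> nu (u m - u n) < e.

Definition cauchy_seq_pred : {pred nat -> V} := fun u => `[< cauchy_seq u >].

Lemma cauchy_seq_submod : submod_closed cauchy_seq_pred.
Proof.
split.
  by apply/asboolP => e e0; exists 0%N => m n _ _; rewrite subrr seminorm0.
move=> a u v /asboolP uc /asboolP vc; apply/asboolP => e e0.
have d0 : 0 < e / 2 / (`|a| + 1) by rewrite !divr_gt0// ltr_wpDl.
have e2 : 0 < e / 2 by rewrite divr_gt0.
have [N uN] := uc _ d0; have [M vM] := vc _ e2.
exists (maxn N M) => m n; rewrite !geq_max => /andP[Nm Mm] /andP[Nn Mn].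
have -> : (a *: u + v) m - (a *: u + v) n = a *: (u m - u n) + (v m - v n).
  by rewrite scalerBr opprD addrACA.
apply: le_lt_trans (seminormD _ _ _) _; rewrite seminormZ.
rewrite [ltRHS](splitr e) ler_ltD// ?vM//.
have := ltW (uN _ _ Nm Nn); rewrite ler_pdivlMr ?ltr_wpDl// mulrC => h.
by apply: le_trans h; rewrite ler_wpM2r ?seminorm_ge0// lerDl.
Qed.

HB.instance Definition _ :=
  GRing.isSubmodClosed.Build R (nat -> V) cauchy_seq_pred cauchy_seq_submod.

(* The completion is the space of Cauchy sequences modulo the sequences whose
   seminorms tend to 0. *)
Record cseq := CSeq { cseq_val :> nat -> V; _ : cseq_val \in cauchy_seq_pred }.
HB.instance Definition _ := [isSub for cseq_val].
HB.instance Definition _ := [Choice of cseq by <:].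
HB.instance Definition _ := [SubChoice_isSubLmodule of cseq by <:].

Lemma cseqP (u : cseq) : cauchy_seq u.
Proof. by case: u => u /= /asboolP. Qed.

Lemma is_cvg_cseq (u : cseq) : cvgn (fun n => nu (u n)).
Proof.
apply: R_complete; apply/cauchy_ballP => e e0; rewrite !near_map2.
have [N uN] := cseqP u e0.
exists ([set n | (N <= n)%N], [set n | (N <= n)%N]).
  by split; apply: nbhs_infty_ge.
move=> [m n] [/= Nm Nn]; rewrite -ball_normE/=.
exact: le_lt_trans (seminorm_dist _ _ _) (uN _ _ Nm Nn).
Qed.

Definition cseq_norm (u : cseq) : R := limn (fun n => nu (u n)).

Lemma cseq_normD u v : cseq_norm (u + v) <= cseq_norm u + cseq_norm v.
Proof.
rewrite /cseq_norm -limD; [|exact: is_cvg_cseq..].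
apply: ler_lim; [exact: is_cvg_cseq| |].
  apply: is_cvgD; exact: is_cvg_cseq.
by apply: nearW => n; exact: seminormD.
Qed.

Lemma cseq_normZ (a : R) u : cseq_norm (a *: u) = `|a| * cseq_norm u.
Proof.
apply: cvg_lim => //.
have -> : (fun n => nu ((a *: u : cseq) n)) = (fun n => `|a| * nu (u n)).
  by apply/funext => n; exact: seminormZ.
by apply: cvgM; [exact: cvg_cst|exact: is_cvg_cseq].
Qed.

Definition cseq_seminorm := Seminorm cseq_normD cseq_normZ.

Definition null_pred : {pred cseq} := fun u => cseq_norm u == 0.

Lemma null_predE u : (u \in null_pred) = (cseq_norm u == 0).
Proof. by []. Qed.

Lemma null_zmod : zmod_closed null_pred.
Proof.
split; first exact/eqP/(seminorm0 cseq_seminorm).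
move=> u v /eqP u0 /eqP v0; apply/eqP/le_anti/andP; split.
  apply: le_trans (seminormD cseq_seminorm _ _) _.
  by rewrite (seminormN cseq_seminorm) /= u0 v0 addr0.
exact: (seminorm_ge0 cseq_seminorm).
Qed.
HB.instance Definition _ := GRing.isZmodClosed.Build cseq null_pred null_zmod.

Definition completion : Type := Quotient.quot null_pred.
HB.instance Definition _ := Choice.on completion.
HB.instance Definition _ := GRing.Zmodule.on completion.
HB.instance Definition _ := EqQuotient.on completion.


Local Open Scope quotient_scope.

Definition cls (u : cseq) : completion := \pi_completion u.
Lemma clsK (x : completion) : cls (repr x) = x. Proof. exact: reprK. Qed.

Lemma pi_eqP (u v : cseq) : cls u = cls v <-> cseq_norm (u - v) = 0.
Proof.
have E : (cseq_norm (u - v) == 0) = (cls u == cls v).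
  exact: (Quotient.idealrBE null_pred u v).
by split=> [uv|uv]; apply/eqP; [rewrite E uv|rewrite -E uv].
Qed.

Lemma repr_piB (u : cseq) : cseq_norm (repr (cls u) - u) = 0.
Proof. by apply/pi_eqP; rewrite clsK. Qed.

Definition completion_scale (a : R) (x : completion) : completion :=
  cls (a *: repr x).

Lemma pi_scale a u :
  completion_scale a (cls u) = cls (a *: u).
Proof.
by apply/pi_eqP; rewrite -scalerBr cseq_normZ repr_piB mulr0.
Qed.

Lemma pi_add (u v : cseq) :
  cls (u + v) = cls u + cls v.
Proof. exact: Quotient.pi_add. Qed.

Lemma cls_opp (u : cseq) : cls (- u) = - cls u.
Proof. exact: Quotient.pi_opp. Qed.

Lemma completion_scaleA a b x :
  completion_scale a (completion_scale b x) = completion_scale (a * b) x.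
Proof. by rewrite -[x]clsK !pi_scale scalerA. Qed.

Lemma completion_scale1 x : completion_scale 1 x = x.
Proof. by rewrite -[x]clsK pi_scale scale1r. Qed.

Lemma completion_scaleDr a x y :
  completion_scale a (x + y) = completion_scale a x + completion_scale a y.
Proof. by rewrite -[x]clsK -[y]clsK -pi_add !pi_scale scalerDr pi_add. Qed.

Lemma completion_scaleDl x a b :
  completion_scale (a + b) x = completion_scale a x + completion_scale b x.
Proof. by rewrite -[x]clsK !pi_scale scalerDl pi_add. Qed.

HB.instance Definition _ := GRing.Zmodule_isLmodule.Build R completion
  completion_scaleA completion_scale1 completion_scaleDr completion_scaleDl.

Lemma clsZ (a : R) u : a *: cls u = cls (a *: u).
Proof. exact: pi_scale. Qed.

Definition completion_norm (x : completion) : R := cseq_norm (repr x).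

Lemma completion_norm_pi u : completion_norm (cls u) = cseq_norm u.
Proof.
apply/eqP; rewrite -subr_eq0 -normr_le0 -(repr_piB u).
exact: (seminorm_dist cseq_seminorm).
Qed.

Lemma completion_normD x y :
  completion_norm (x + y) <= completion_norm x + completion_norm y.
Proof.
by rewrite -[x]clsK -[y]clsK -pi_add !completion_norm_pi cseq_normD.
Qed.

Lemma completion_normZ (a : R) x :
  completion_norm (a *: x) = `|a| * completion_norm x.
Proof. by rewrite completion_norm_pi cseq_normZ. Qed.

Lemma completion_norm0_eq0 x : completion_norm x = 0 -> x = 0.
Proof.
have <- : cls 0 = 0 by exact: pi_zeror.
by move=> x0; rewrite -[x]clsK; apply/pi_eqP; rewrite subr0.
Qed.

HB.instance Definition _ := isPointed.Build completion 0.
HB.instance Definition _ := @Lmodule_isNormed.Build R completion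
  completion_norm completion_normD completion_normZ completion_norm0_eq0.

Lemma cst_cauchy (x : V) : (fun=> x) \in cauchy_seq_pred.
Proof.
by apply/asboolP => e e0; exists 0%N => m n _ _; rewrite subrr seminorm0.
Qed.

Definition completion_in (x : V) : completion := cls (CSeq (cst_cauchy x)).

Lemma completion_in_linear : linear completion_in.
Proof.
move=> a x y; rewrite /completion_in clsZ -pi_add.
by congr (cls _); apply: val_inj.
Qed.

HB.instance Definition _ := GRing.isLinear.Build R V completion *:%R
  completion_in completion_in_linear.

Lemma completion_in_norm x : `|completion_in x| = nu x.
Proof. rewrite [LHS]completion_norm_pi.
rewrite /cseq_norm (_ : (fun n => _) = cst (nu x))//; exact: lim_cst. Qed.

Lemma cseq_lim (u : cseq) (e : R) : 0 < e ->
  exists N, forall n, (N <= n)%N -> `|cls u - completion_in (u n)| < e.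
Proof.
move=> e0; have e2 : 0 < e / 2 by rewrite divr_gt0.
have [N uN] := cseqP u e2; exists N => n Nn.
have -> : cls u - completion_in (u n) = cls (u - CSeq (cst_cauchy (u n))).
  by rewrite pi_add cls_opp.
rewrite [ltLHS]completion_norm_pi; apply: (@le_lt_trans _ _ (e / 2)); last lra.
apply: limr_le; first exact: is_cvg_cseq.
by exists N => // m /= Nm; exact/ltW/uN.
Qed.

Lemma completion_in_dense (x : completion) (e : R) : 0 < e ->
  exists v, `|x - completion_in v| < e.
Proof.
move=> e0; have [N uN] := cseq_lim (repr x) e0.
by exists (repr x N); rewrite -[x in x - _]clsK uN.
Qed.

Lemma completion_complete (F : set_system completion) :
  ProperFilter F -> cauchy F -> cvg F.
Proof.
move=> FF Fc.
have e_ n : 0 < n.+1%:R^-1 :> R by rewrite invr_gt0.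
have vF n : exists v, F (ball (completion_in v) n.+1%:R^-1).
  have e2 : 0 < n.+1%:R^-1 / 2 :> R by rewrite divr_gt0.
  have [x Fx] := (cauchyP F).1 Fc _ e2.
  have [v xv] := completion_in_dense x e2; exists v.
  apply: filterS Fx => y; rewrite -!ball_normE /= => xy.
  have := ler_normD (completion_in v - x) (x - y); rewrite addrA subrK.
  rewrite (distrC (completion_in v) x) => h.
  by rewrite [ltRHS](splitr n.+1%:R^-1); apply: le_lt_trans h _; exact: ltrD.
have /choice[v Fv] := vF.
have vc : v \in cauchy_seq_pred.
  apply/asboolP => e e0; have e2 : 0 < e / 2 by rewrite divr_gt0.
  have [N /= _ NP] := near_infty_natSinv_lt (PosNum e2).
  exists N => m n Nm Nn.
  have [y [my ny]] := filter_ex (filterI (Fv m) (Fv n)).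
  move: my ny; rewrite -!ball_normE /= => my ny.
  rewrite -completion_in_norm linearB /=.
  have := ler_normD (completion_in (v m) - y) (y - completion_in (v n)).
  rewrite addrA subrK (distrC y).
  have h1 : m.+1%:R^-1 < e / 2 by exact: NP.
  have h2 : n.+1%:R^-1 < e / 2 by exact: NP.
  move: m.+1%:R^-1 n.+1%:R^-1 my ny h1 h2 => a b *; lra.
apply/cvg_ex; exists (cls (CSeq vc)); apply/cvgrPdist_lt => e e0.
have e2 : 0 < e / 2 by rewrite divr_gt0.
have [N vN] := cseq_lim (CSeq vc) e2.
have [M /= _ MP] := near_infty_natSinv_lt (PosNum e2).
set n := maxn N M; apply: filterS (Fv n) => y; rewrite -ball_normE/= => ny.
have := ler_normD (cls (CSeq vc) - completion_in (v n)) (completion_in (v n) - y).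
rewrite addrA subrK; have := vN n (leq_maxl _ _).
have h1 : n.+1%:R^-1 < e / 2 by exact/MP/leq_maxr.
rewrite [CSeq vc n]/=; move: n.+1%:R^-1 ny h1 => a *; lra.
Qed.

HB.instance Definition _ := Uniform_isComplete.Build completion completion_complete.
End completion.

Lemma ell_exponent (R : realType) (p : R) : 1 <= p -> (1 <= p%:E)%E.
Proof. by rewrite lee_fin. Qed.

Section ell.
Context (R : realType) (p : R) (hp : 1 <= p).

(* A function on nat is null almost everywhere for the counting measure only
   if it is null, so no quotient is needed. *)
Definition ell : Type := LfunType (@counting nat R) (ell_exponent hp).
HB.instance Definition _ := GRing.Lmodule.on ell.
Definition ell_norm (x : ell) : R := fine ('N[@counting nat R]_p%:E[EFin \o x])%E.

Lemma ell_normD (x y : ell) : ell_norm (x + y) <= ell_norm x + ell_norm y.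
Proof. exact: ler_LnormD. Qed.
Lemma ell_normZ (a : R) (x : ell) : ell_norm (a *: x) = `|a| * ell_norm x.
Proof.
apply: EFin_inj; rewrite EFinM /ell_norm !finite_norm_fine.
exact: LnormZ.
Qed.

Lemma poweR_ell_norm (x : ell) :
  ((ell_norm x `^ p)%:E = \sum_(0 <= k <oo) (`|x k| `^ p)%:E)%E.
Proof.
have p0 : p != 0 by rewrite gt_eqF// (lt_le_trans ltr01).
rewrite -poweR_EFin /ell_norm finite_norm_fine poweR_Lnorm//.
rewrite ge0_integral_count//= => k; rewrite lee_fin powR_ge0.
Qed.

Lemma ell_norm_ge0 (x : ell) : 0 <= ell_norm x.
Proof. by rewrite fine_ge0// Lnorm_ge0. Qed.

Lemma ell_sum_le (x : ell) n :
  \sum_(0 <= k < n) `|x k| `^ p <= ell_norm x `^ p.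
Proof.
rewrite -lee_fin -sumEFin poweR_ell_norm; apply: nneseries_lim_ge => k _ _.
by rewrite lee_fin powR_ge0.
Qed.

Lemma ell_intro (f : nat -> R) (C : R) : 0 <= C ->
  (forall n, \sum_(0 <= k < n) `|f k| `^ p <= C `^ p) ->
  exists2 x : ell, (x : nat -> R) = f & ell_norm x <= C.
Proof.
move=> C0 fC.
have p0 : 0 < p by rewrite (lt_le_trans ltr01).
have N_le : ('N[@counting nat R]_p%:E[EFin \o f] <= C%:E)%E.
  rewrite unlock /Lnorm.
  rewrite -(@powRr1 _ C)// -(@mulfV _ p) ?gt_eqF// powRrM -poweR_EFin.
  apply: gt0_ler_poweR; rewrite ?invr_ge0 ?(ltW p0)// ?in_itv/= ?leey ?andbT.
  - by apply: integral_ge0 => k _; rewrite lee_fin powR_ge0.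
  - by rewrite lee_fin powR_ge0.
  rewrite ge0_integral_count; last by move=> k; rewrite lee_fin powR_ge0.
  apply: lime_le.
    by apply: is_cvg_nneseries => k _ _; rewrite lee_fin powR_ge0.
  apply: nearW => n; rewrite (le_trans _ (_ : ((\sum_(0 <= k < n) `|f k| `^ p)%:E <= _)%E))//.
    by rewrite -sumEFin; apply: lee_sum => k _ /=.
  by rewrite lee_fin.
have fP : f \in Lfun (@counting nat R) p%:E.
  rewrite inE; apply/andP; split; rewrite inE //=.
  by rewrite /finite_norm (le_lt_trans N_le)// ltry.
exists (Lfun_Sub (ell_exponent hp) fP) => //.
by rewrite -lee_fin /ell_norm finite_norm_fine.
Qed.

Lemma ell_coord_le (x : ell) k : `|x k| <= ell_norm x.
Proof.
have p0 : 0 < p by rewrite (lt_le_trans ltr01).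
have : `|x k| `^ p <= ell_norm x `^ p.
  apply: le_trans (ell_sum_le x k.+1).
  rewrite big_nat_recr//= lerDr; apply: sumr_ge0 => i _; exact: powR_ge0.
apply: contraTT; rewrite -!ltNge => xk.
by apply: gt0_ltr_powR; rewrite ?nnegrE// ell_norm_ge0.
Qed.

Lemma ell_norm0_eq0 (x : ell) : ell_norm x = 0 -> x = 0.
Proof.
move=> x0; apply/LfuneqP => k; apply/eqP; rewrite -normr_le0 -x0.
exact: ell_coord_le.
Qed.

HB.instance Definition _ := isPointed.Build ell 0.
HB.instance Definition _ :=
  @Lmodule_isNormed.Build R ell ell_norm ell_normD ell_normZ ell_norm0_eq0.

Lemma ell_normE (x : ell) : `|x| = ell_norm x. Proof. by []. Qed.

Lemma ell_complete (F : set_system ell) : ProperFilter F -> cauchy F -> cvg F.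
Proof.
move=> FF /cauchy_ballP Fc.
have p0 : 0 < p by rewrite (lt_le_trans ltr01).
have coordB (y z : ell) k : (y - z : ell) k = y k - z k by [].
have cball e : 0 < e -> exists f, F (ball f e).
  by move=> e0; exact: ((cauchyP F).1 ((cauchy_ballP F).1 Fc)).
pose ev k (y : ell) : R := y k.
have cvg_ev k : cvg (ev k y @[y --> F]).
  apply: R_complete; apply/cauchyP => e e0; have [f Ff] := cball e e0.
  exists (f k); change (\forall y \near F, ball (f k) e (ev k y)).
  apply: filterS Ff => y; rewrite -!ball_normE /= => fy.
  exact: le_lt_trans (ell_coord_le (f - y) k) fy.
pose l k := lim (ev k y @[y --> F]).
have key e (f : ell) : 0 < e -> F (ball f e) ->
  exists2 x : ell, (x : nat -> R) = l & ell_norm (f - x) <= e *+ 2.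
  move=> e0 Ff.
  have [n|h hE hn] := @ell_intro (fun k => (f k - l k) / 2) e (ltW e0).
    have : \forall y \near F, forall k, (k < n)%N -> `|(f k - l k) / 2| <= `|f k - (y : ell) k|.
      elim: n => [|n IHn]; first by apply: nearW.
      suff : \forall y \near F, `|(f n - l n) / 2| <= `|f n - (y : ell) n|.
        apply: filterS2 IHn => y yn ynn k.
        by rewrite ltnS leq_eqVlt => /predU1P[->//|]; exact: yn.
      have [->|fl] := eqVneq (f n - l n) 0.
        by apply: nearW => y; rewrite mul0r normr0.
      have d0 : 0 < `|f n - l n| / 2 by rewrite divr_gt0// normr_gt0.
      have /cvgrPdist_lt/(_ _ d0) := cvg_ev n.
      apply: filterS => y; rewrite -/(l n) /ev /= => ly.
      rewrite normrM normfV (@ger0_norm _ 2)//.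
      have := ler_normD (f n - y n) (y n - l n); rewrite addrA subrK => h.
      rewrite distrC in ly; lra.
    move=> nF; have [y [yn yf]] := filter_ex (filterI nF Ff).
    move: yf; rewrite -ball_normE /= => yf.
    apply: (@le_trans _ _ (ell_norm (f - y) `^ p)); last first.
      by apply: (ge0_ler_powR (ltW p0)); rewrite ?nnegrE ?ell_norm_ge0// ltW.
    apply: le_trans (ell_sum_le (f - y) n).
    rewrite big_nat_cond [leRHS]big_nat_cond; apply: ler_sum => k /andP[kn _].
    apply: (ge0_ler_powR (ltW p0)); rewrite ?nnegrE//.
    by apply: yn; case/andP: kn.
  exists (f - 2 *: h).
    apply/funext => k; rewrite coordB.
    have -> : (2 *: h : ell) k = 2 * h k by [].
    by rewrite hE mulrC divfK// subKr.
  by rewrite subKr ell_normZ ger0_norm// mulr2n; lra.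
have [f1 Ff1] := cball 1 ltr01.
have [l0 l0E _] := key 1 f1 ltr01 Ff1.
apply/cvg_ex; exists l0; apply/cvgrPdist_lt => e e0.
have e4 : 0 < e / 4 by rewrite divr_gt0.
have [f Ff] := cball _ e4; have [x xE fx] := key _ _ e4 Ff.
have -> : l0 = x by apply/LfuneqP => k; rewrite l0E xE.
apply: filterS Ff => y; rewrite -ball_normE/= => fy.
have := ler_normD (x - f) (f - y); rewrite addrA subrK (distrC x f).
move: fx; rewrite -ell_normE mulr2n => *; lra.
Qed.

HB.instance Definition _ := Uniform_isComplete.Build ell ell_complete.

Lemma ell_basis_ex (n : nat) :
  exists2 x : ell, (x : nat -> R) = (fun m => (m == n)%:R) & ell_norm x <= 1.
Proof.
apply: ell_intro => // m; rewrite powR1.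
have p0 : p != 0 by rewrite gt_eqF// (lt_le_trans ltr01).
have E k : `|(k == n)%:R : R| `^ p = (k == n)%:R.
  by rewrite normr_nat; case: (k == n); rewrite ?powR1 ?powR0.
under eq_bigr do rewrite E.
rewrite big_mkord; have [nm|mn] := ltnP n m.
  rewrite (bigD1 (Ordinal nm))//= eqxx big1 ?addr0// => i.
  by move=> /negPf/=; rewrite -val_eqE /= => ->.
rewrite big1// => i _; rewrite ltn_eqF// (leq_trans _ mn)//.
Qed.

Definition ell_basis (n : nat) : ell := s2val (cid2 (ell_basis_ex n)).
Lemma ell_basisE n m : ell_basis n m = (m == n)%:R.
Proof. by rewrite /ell_basis; case: cid2 => x /= ->. Qed.

End ell.

Section spreading_models.
Context (R : realType).

Definition lin_span (V : lmodType R) (e : nat -> V) : set V :=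
  [set x | exists n (a : 'I_n -> R), x = \sum_(j < n) a j *: e j].

Definition hamel_basis (V : lmodType R) (e : nat -> V) : Prop :=
  (forall n (a : 'I_n -> R), \sum_(j < n) a j *: e j = 0 -> forall j, a j = 0) /\
  lin_span e = setT.

(* The infinite set M is given by its increasing enumeration.  Only the values
   of x on the members of F included in M matter.  As indices start
   at 0, a tuple with k + 1 members is compared with M l and delta l for
   k <= l. *)
Definition generates (X : completeNormedModType R) (F : family)
    (M : nat -> nat) (x : {fset nat} -> X)
    (V : lmodType R) (nu : seminorm V) (e : nat -> V) : Prop :=
  exists delta : nat -> R,
    [/\ forall n, 0 < delta n, delta @ \oo --> 0
      & forall k l, (k <= l)%N ->
          forall s : 'I_k.+1 -> {fset nat},
            (forall j, F (s j) /\ [set` s j] `<=` range M) -> plegma s ->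
            (M l <= el (s ord0) 0)%N ->
          forall a : 'I_k.+1 -> R, (forall j, -1 <= a j <= 1) ->
            `| `|\sum_(j < k.+1) a j *: x (s j)| -
               nu (\sum_(j < k.+1) a j *: e j) | <= delta l].

Definition spreading_model_of_order (xi : cord) (X : completeNormedModType R)
    (V : lmodType R) (nu : seminorm V) (e : nat -> V) : Prop :=
  hamel_basis e /\
  exists F : family, [/\ regular_thin F, has_order F xi
    & exists (M : nat -> nat) (x : {fset nat} -> X),
        {homo M : m n / (m < n)%N} /\ generates F M x nu e].

Definition spreading_model (X : completeNormedModType R)
    (V : lmodType R) (nu : seminorm V) (e : nat -> V) : Prop :=
  exists xi, cord_le cord1 xi /\ spreading_model_of_order xi X nu e.

Definition nontrivial (V : lmodType R) (nu : seminorm V) (e : nat -> V) : Prop :=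
  forall x, lin_span e x -> nu x = 0 -> x = 0.

Definition normalized (V : lmodType R) (nu : seminorm V) (e : nat -> V) : Prop :=
  forall n, nu (e n) = 1.

Definition schauder_basis (E : normedModType R) (u : nat -> E) : Prop :=
  forall x : E, exists! a : nat -> R,
    (fun n => \sum_(0 <= k < n) a k *: u k) @ \oo --> x.

(* Below e is a Hamel basis of V, so completion nu is the completion of its
   span. *)
Definition schauder_basic (V : lmodType R) (nu : seminorm V) (e : nat -> V) :
  Prop := @schauder_basis (completion nu) (fun n => completion_in nu (e n)).

Definition singular (V : lmodType R) (nu : seminorm V) (e : nat -> V) : Prop :=
  nontrivial nu e /\ ~ schauder_basic nu e.

Definition isometric_sequences (U V : lmodType R) (nu : U -> R) (mu : V -> R)
    (u : nat -> U) (v : nat -> V) : Prop :=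
  forall n (a : 'I_n -> R),
    nu (\sum_(j < n) a j *: u j) = mu (\sum_(j < n) a j *: v j).

Definition equivalent_sequences (U V : lmodType R) (nu : U -> R) (mu : V -> R)
    (u : nat -> U) (v : nat -> V) : Prop :=
  exists c C : R, [/\ 0 < c, 0 < C & forall n (a : 'I_n -> R),
    c * mu (\sum_(j < n) a j *: v j) <= nu (\sum_(j < n) a j *: u j) /\
    nu (\sum_(j < n) a j *: u j) <= C * mu (\sum_(j < n) a j *: v j)].

Definition isometric_spaces (E G : normedModType R) : Prop :=
  exists T : {linear E -> G},
    (forall x, `|T x| = `|x|) /\ (forall y, exists x, T x = y).

End spreading_models.

(* Main.v *)
(* Let the spreading model of ell^p be generated by (x_s), s in F.  Extend x to
   the tree of initial segments of members of F by taking, from the leaves to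
   the root, limits along a fixed ultrafilter, coordinate by coordinate; call
   w the vector at the root.  Along a sufficiently sparse sequence m_0 < m_1 < ...
   passing from t to t U {m_i} changes the vector, up to a small error, only
   on a block I_i of coordinates, and these blocks are disjoint.  Hence
   x_s = w + v_s up to a small error, where v_s lives on the blocks I_i with
   m_i in s, so that for a plegma tuple (which consists of disjoint sets)
     |sum_j a_j x_(s_j)|^p = |w|^p |sum_j a_j|^p + sum_j |v_(s_j)|^p |a_j|^p
   up to a small error.  Comparing the coefficients with the values of the
   seminorm at e_0 and at e_0 - e_1, one finds in the limit that
     nu (sum_j a_j e_j)^p = al^p |sum_j a_j|^p + be^p sum_j |a_j|^p
   for all a, with constants al, be >= 0.  So (e_j) is isometric to the sequence
   al b_0 + be b_(j+1) of ell^p, where b is the unit vector basis.  The spreading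
   model is nontrivial only if be > 0.  If p > 1, the averages of this
   sequence converge to al b_0, so it is Schauder basic only if al = 0,
   and in every case it spans an isometric copy of ell^p. *)
From HB Require Import structures.
Require Import Defs.
From mathcomp Require Import all_boot all_order all_algebra finmap.
From mathcomp Require Import all_classical all_reals all_analysis.
From mathcomp Require Import zify lra ring.
Import Order.TTheory GRing.Theory Num.Theory.
Import numFieldNormedType.Exports.
Local Open Scope classical_set_scope.
Local Open Scope ring_scope.
Set Implicit Arguments.
Unset Strict Implicit.
Unset Printing Implicit Defensive.

(** * Trees of initial segments *)


Lemma mem_elts (s : {fset nat}) x : (x \in elts s) = (x \in s).
Proof. by rewrite mem_sort. Qed.

Lemma size_elts (s : {fset nat}) : size (elts s) = #|` s |.
Proof. by rewrite size_sort. Qed.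

Lemma sorted_elts (s : {fset nat}) : sorted ltn (elts s).
Proof.
by rewrite ltn_sorted_uniq_leq sort_uniq fset_uniq sort_sorted//; exact: leq_total.
Qed.

Lemma elts_inj : injective elts.
Proof. by move=> s t st; apply/fsetP => x; rewrite -!mem_elts st. Qed.

Lemma elts_seq q : sorted ltn q -> elts [fset x in q]%fset = q.
Proof.
move=> qs; apply: (irr_sorted_eq ltn_trans ltnn) => //; first exact: sorted_elts.
by move=> x; rewrite mem_elts inE.
Qed.

Lemma sorted_rcons_ltn q n : sorted ltn q -> (forall x, x \in q -> (x < n)%N) ->
  sorted ltn (rcons q n).
Proof.
case: q => // a q /= aq qn; rewrite rcons_path aq /=.
by apply: qn; exact: mem_last.
Qed.

Lemma elts_fsetU1 (t : {fset nat}) n : (forall x, x \in t -> (x < n)%N) ->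
  elts (n |` t)%fset = rcons (elts t) n.
Proof.
move=> tn.
have -> : (n |` t)%fset = [fset x in rcons (elts t) n]%fset.
  by apply/fsetP => x; rewrite !inE mem_rcons inE mem_elts.
apply/elts_seq/sorted_rcons_ltn; first exact: sorted_elts.
by move=> x; rewrite mem_elts; exact: tn.
Qed.

Lemma proper_initial_fsetU1 (t : {fset nat}) n : (forall x, x \in t -> (x < n)%N) ->
  proper_initial t (n |` t)%fset.
Proof.
move=> tn; rewrite /proper_initial /initial elts_fsetU1// prefix_rcons /=.
by apply/eqP => /fsetP/(_ n); rewrite !inE eqxx /= => /tn; rewrite ltnn.
Qed.

Lemma initial_subset (t s : {fset nat}) : initial t s -> (t `<=` s)%fset.
Proof.
move=> /prefixP[q E]; apply/fsubsetP => x.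
by rewrite -!mem_elts E mem_cat => ->.
Qed.

(** If [t] lies between [s] and a member [r] of [F], thinness forces [s = r], and then [t] is
    squeezed between equal sets. *)
Lemma leaf_not_proper (F : Defs.family) (s t : {fset nat}) : thin F ->
  F s -> closure_initial F t -> ~~ proper_initial s t.
Proof.
move=> thF Fs [r Fr tr]; apply/negP => /andP[st nst].
have /negP := thF _ _ Fs Fr; apply; rewrite /proper_initial.
apply/andP; split; first exact: prefix_trans st tr.
apply: contra nst => /eqP sr; subst r; apply/eqP/elts_inj.
have /prefixP[q E] := st; have /prefixP[q' E'] := tr.
move: E'; rewrite E -catA -[LHS]cats0 => /eqP; rewrite eqseq_cat// eqxx /=.
by case: q E => [|//] /=; rewrite cats0.
Qed.

Lemma closure_initial_trans (F : Defs.family) (s t : {fset nat}) :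
  closure_initial F t -> initial s t -> closure_initial F s.
Proof. by move=> [r Fr tr] st; exists r => //; exact: prefix_trans st tr. Qed.

Lemma sub_closure_initial (F : Defs.family) : F `<=` closure_initial F.
Proof. by move=> s Fs; exists s => //; exact: prefix_refl. Qed.

(** A node outside [F] is continued in some member of [F] by an element [m]; spreading then moves
    [m] up to any larger [n]. *)
Lemma closure_initial_extend (F : Defs.family) (t : {fset nat}) :
  spreading (closure_initial F) -> closure_initial F t -> ~ F t ->
  exists b, forall n, (b <= n)%N ->
    (forall x, x \in t -> (x < n)%N) /\ closure_initial F (n |` t)%fset.
Proof.
move=> spF [s Fs /prefixP[[|m q] E]] nFt.
  by case: nFt; move: E; rewrite cats0 => /elts_inj <-.
have tm x : x \in t -> (x < m)%N.
  move=> xt; have := sorted_elts s; rewrite E sorted_pairwise; last exact: ltn_trans.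
  rewrite pairwise_cat => /and3P[/allrelP + _ _].
  by apply; rewrite ?mem_head// mem_elts.
have tmF : closure_initial F (m |` t)%fset.
  exists s => //; rewrite /initial elts_fsetU1// -cats1; apply/prefixP.
  by exists q; rewrite -catA.
exists m => n mn.
have tn x : x \in t -> (x < n)%N by move=> /tm /leq_trans; exact.
split=> //; apply: spF tmF _ _; rewrite -!size_elts !elts_fsetU1 ?size_rcons//.
move=> k; rewrite ltnS leq_eqVlt /el !elts_fsetU1// !nth_rcons.
by case/predU1P => [->|->//]; rewrite ltnn eqxx.
Qed.

(** A term below [ssup f] need not be a subterm, only [cord_le] one of the [f m]; hence the
    induction carries all [b] below [a] at once. *)
Lemma cord_lt_wf : well_founded cord_lt.
Proof.
suff H a : forall b, cord_le b a -> Acc cord_lt b.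
  by move=> a; exact: H (cord_le_refl a).
elim: a => [|f IH] b ba; constructor=> c cb.
  by case: b ba cb.
have /= [m cm] := cord_lt_le_trans cb ba; exact: IH cm.
Qed.

(** Longer sets count as smaller, so that well-founded recursion runs from the leaves to the
    root. *)
Definition tree_lt (F : Defs.family) (t' t : {fset nat}) : Prop :=
  [/\ closure_initial F t, closure_initial F t' & proper_initial t t'].

Lemma tree_lt_wf (F : Defs.family) rk :
  is_tree_rank (closure_initial F) rk -> well_founded (tree_lt F).
Proof.
move=> Frk t; have [n nE] : exists a, a = rk t by exists (rk t).
elim/(well_founded_ind cord_lt_wf): n t nE => a IH t E.
constructor=> t' [Tt Tt' tt']; apply: IH erefl; rewrite E.
by have [+ _] := Frk _ Tt; exact.
Qed.

(** If the empty set were in [F], thinness would leave it no proper extension in the tree, and the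
    order would be 0. *)
Lemma order_ge1_fset0 (F : Defs.family) xi : thin F ->
  cord_le cord1 xi -> has_order F xi -> ~ F fset0.
Proof.
move=> thF xi1 [T0 [rk [Frk [_ xirk]]]] F0.
have [_ /(_ cord0) h] := Frk _ T0.
suff /h rk0 : forall t, closure_initial F t -> proper_initial fset0 t ->
    cord_lt (rk t) cord0.
  by have := cord_le_trans (cord_le_trans xi1 xirk) rk0 => /=.
by move=> t /(leaf_not_proper thF F0)/negP.
Qed.

(** * The space ell^p *)


(** Compactness of the interval gives a cluster point, and a cluster point of an ultrafilter is a
    limit. *)
Lemma ultra_bounded_cvg (R : realType) (T : Type) (U : set_system T)
    (f : T -> R) (C : R) :
  UltraFilter U -> (\forall n \near U, `|f n| <= C) -> exists l : R, f @ U --> l.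
Proof.
move=> UU fC.
have fU : (f @ U) `[(- C), C]%classic.
  by apply: filterS fC => x; rewrite ler_norml /= in_itv.
have [l [_ lf]] := @segment_compact R (- C) C (f @ U) _ fU.
exists l; apply/cvgrPdist_lt => e e0.
have [h|nU] := in_ultra_setVsetC (fun t => `|l - f t| < e) UU; first exact: h.
have nU' : (f @ U) (~` ball l e).
  by rewrite -ball_normE; exact: nU.
by have [y []] := lf _ _ nU' (nbhsx_ballx l e e0).
Qed.

Lemma norm_powR_continuous (R : realType) (p : R) : 0 < p ->
  continuous (fun x : R => `|x| `^ p).
Proof.
move=> p0 l; have [->|l0] := eqVneq l 0.
  apply/cvgrPdist_lt => e e0; rewrite normr0 powR0 ?gt_eqF//.
  have d0 : 0 < e `^ p^-1 by rewrite powR_gt0.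
  apply: filterS (nbhsx_ballx (0 : R) _ d0) => y.
  rewrite -ball_normE /= sub0r normrN sub0r normrN (ger0_norm (powR_ge0 _ _)) => ye.
  rewrite -[ltRHS]powRr1 ?ltW// -(mulVf (lt0r_neq0 p0)) powRrM.
  by apply: gt0_ltr_powR; rewrite ?nnegrE// powR_ge0.
apply: (@continuous_comp _ _ _ (fun x : R => `|x|) (fun x => x `^ p)).
  exact: norm_continuous.
apply: differentiable_continuous; apply/derivable1_diffP.
by apply: derivable_powR; rewrite in_itv/= andbT normr_gt0.
Qed.

Section ell_theory.
Context (R : realType) (p : R) (hp : 1 <= p).
Let p_gt0 : 0 < p := lt_le_trans ltr01 hp.
Implicit Types (x y : ell hp) (P : pred nat).

Lemma ellD x y k : (x + y) k = x k + y k. Proof. by []. Qed.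
Lemma ellZ (a : R) x k : (a *: x) k = a * x k. Proof. by []. Qed.

Lemma ell_eqP x y : (forall k, x k = y k) -> x = y.
Proof. by move=> xy; apply/LfuneqP => k; rewrite xy. Qed.

Lemma ell_evalB x y k : (x - y) k = x k - y k. Proof. by []. Qed.

Lemma ell_eval_sum n (f : nat -> ell hp) k :
  (\sum_(j < n) f j) k = \sum_(j < n) f j k.
Proof. by elim: n => [|n IH]; rewrite ?big_ord0// !big_ord_recr/= -IH. Qed.

Lemma ell_norm_disjoint x y : (forall k, x k = 0 \/ y k = 0) ->
  `|x + y| `^ p = `|x| `^ p + `|y| `^ p.
Proof.
move=> xy; apply: EFin_inj; rewrite EFinD !ell_normE !poweR_ell_norm -nneseriesD.
- apply: eq_eseriesr => k _; rewrite -EFinD ellD.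
  by case: (xy k) => ->; rewrite ?(add0r, addr0) normr0 powR0 ?gt_eqF// ?(add0r, addr0).
- by move=> k _ _; rewrite lee_fin powR_ge0.
- by move=> k _ _; rewrite lee_fin powR_ge0.
Qed.

Lemma restr_ex P x :
  exists2 z : ell hp, (z : nat -> R) = (fun k => if P k then x k else 0) &
    ell_norm z <= `|x|.
Proof.
apply: ell_intro => // n; apply: le_trans (ell_sum_le x n).
apply: ler_sum => k _; case: (P k) => //.
by rewrite normr0 powR0 ?powR_ge0// gt_eqF.
Qed.

Definition restr P x : ell hp := s2val (cid2 (restr_ex P x)).

Lemma restrE P x k : restr P x k = if P k then x k else 0.
Proof. by rewrite /restr; case: cid2 => z /= ->. Qed.

Lemma restrC P x : x = restr P x + restr (predC P) x.
Proof.
by apply: ell_eqP => k; rewrite ellD !restrE /=; case: (P k); rewrite ?(addr0, add0r).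
Qed.

Lemma restrB P x y : restr P (x - y) = restr P x - restr P y.
Proof.
apply: ell_eqP => k; rewrite ell_evalB !restrE ell_evalB.
by case: (P k); rewrite ?subr0.
Qed.

(** This crude bound turns coordinatewise convergence into norm convergence of any fixed finite
    head. *)
Lemma restr_head N x : `|restr (fun k => (k < N)%N) x| <= \sum_(k < N) `|x k|.
Proof.
have -> : restr (fun k => (k < N)%N) x = \sum_(k < N) x k *: ell_basis hp k.
  apply: ell_eqP => m; rewrite restrE.
  rewrite (ell_eval_sum N (fun k => x k *: ell_basis hp k)).
  under eq_bigr do rewrite ellZ ell_basisE.
  case: ltnP => mN.
    rewrite (bigD1 (Ordinal mN))//= eqxx mulr1 big1 ?addr0// => i.
    by rewrite -val_eqE eq_sym /= => /negPf ->; rewrite mulr0.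
  by rewrite big1// => i _; rewrite gtn_eqF ?mulr0// (leq_trans _ mN).
apply: le_trans (ler_norm_sum _ _ _) _; apply: ler_sum => k _.
rewrite normrZ ler_piMr// /ell_basis; by case: cid2.
Qed.

(** Head and tail have disjoint supports, so the p-th power of the norm of the tail is at most what
    the partial sum misses of the whole. *)
Lemma ell_tail x (eps : R) : 0 < eps ->
  exists N, forall n, (N <= n)%N -> `|restr (fun k => (n <= k)%N) x| <= eps.
Proof.
move=> e0.
have : (fun n => (\sum_(0 <= k < n) (`|x k| `^ p)%:E)%E) @ \oo --> (`|x| `^ p)%:E.
  rewrite ell_normE poweR_ell_norm; apply: is_cvg_nneseries => k _ _.
  by rewrite lee_fin powR_ge0.
under eq_cvg do rewrite sumEFin.
move=> /fine_cvg /cvgrPdist_lt /(_ (eps `^ p)); rewrite powR_gt0// => /(_ isT)[N _ NP].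
exists N => n /NP /=; rewrite ger0_norm ?subr_ge0 ?ell_sum_le//.
set Q : pred nat := fun k => (n <= k)%N.
have := restrC Q x => /(congr1 (fun y => `|y| `^ p)).
rewrite ell_norm_disjoint; last first.
  by move=> k; rewrite !restrE /=; case: (Q k); [right|left].
move=> -> h.
have : `|restr Q x| `^ p < eps `^ p.
  apply: le_lt_trans h; rewrite -addrA lerDl subr_ge0.
  apply: le_trans (ell_sum_le _ n); rewrite !big_nat; apply: ler_sum => k /andP[_ kn].
  by rewrite restrE /Q /= -ltnNge kn.
apply: contraTT; rewrite -ltNge -leNgt => h'.
by apply: (ge0_ler_powR (ltW p_gt0)); rewrite ?nnegrE// ltW.
Qed.

(** The bound passes to the limit in each finite partial sum, which puts the coordinatewise limit in
    the ball. For [p = 1] this is a weak-star limit. *)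
Lemma ell_weak_limit (U : set_system nat) (g : nat -> ell hp) (C : R) :
  UltraFilter U -> (\forall n \near U, `|g n| <= C) ->
  exists2 z : ell hp, `|z| <= C & forall k, g n k @[n --> U] --> z k.
Proof.
move=> UU gC; have C0 : 0 <= C.
  by have [n] := filter_ex gC; apply: le_trans.
have /choice[l gl] k : exists l : R, g n k @[n --> U] --> l.
  apply: (ultra_bounded_cvg (C := C)); apply: filterS gC => n.
  exact/le_trans/ell_coord_le.
have [n|z zE zC] := @ell_intro _ _ hp l C C0; last first.
  by exists z => // k; rewrite zE; exact: gl.
have h : (\sum_(0 <= k < n) `|g m k| `^ p) @[m --> U] --> \sum_(0 <= k < n) `|l k| `^ p.
  apply: cvg_big => [|k _]; first exact: add_continuous.
  by apply: (continuous_cvg _ (@norm_powR_continuous _ _ p_gt0 _)); exact: gl.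
apply: cvgr_to_le h _.
apply: filterS gC => m mC; apply: le_trans (ell_sum_le _ _) _.
by apply: (ge0_ler_powR (ltW p_gt0)); rewrite ?nnegrE// -ell_normE.
Qed.

End ell_theory.

(** * Limits along the tree *)


Lemma homo_geq_id (M : nat -> nat) : {homo M : m n / (m < n)%N} ->
  forall n, (n <= M n)%N.
Proof. by move=> Mh; elim=> // n IH; apply: leq_ltn_trans IH _; exact: Mh. Qed.

(** Any ultrafilter finer than the image under [M] of the filter of cofinite sets will do. *)
Lemma ultra_on_range (M : nat -> nat) : {homo M : m n / (m < n)%N} ->
  exists U : set_system nat,
    [/\ UltraFilter U, U (range M) & forall b, \forall n \near U, (b <= n)%N].
Proof.
move=> Mh; have [U [UU MU]] := @ultraFilterLemma _ (M @ \oo) _.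
exists U; split=> //.
  by apply: MU; exists 0%N => // n _ /=; exists n.
move=> b; apply: MU; exists b => // n /= bn.
exact: leq_trans bn (homo_geq_id Mh n).
Qed.

Section tree_limits.
Context (R : realType) (p : R) (hp : 1 <= p).
Context (F : Defs.family) (M : nat -> nat) (x : {fset nat} -> ell hp) (C : R).
Hypothesis spF : spreading (closure_initial F).
Hypothesis wfF : well_founded (tree_lt F).
Hypothesis xC : forall s, F s -> [set` s] `<=` range M -> `|x s| <= C.

Definition node (t : {fset nat}) := closure_initial F t /\ [set` t] `<=` range M.

Lemma node_initial (s t : {fset nat}) : node t -> initial s t -> node s.
Proof.
move=> [Tt tM] st; split; first exact: closure_initial_trans Tt st.
by move=> k /= /(fsubsetP (initial_subset st)); exact: tM.
Qed.

Section weak_limits.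
Context (U : set_system nat) (UU : UltraFilter U) (UM : U (range M)).
Hypothesis Uoo : forall b, \forall n \near U, (b <= n)%N.

Lemma node_extend t : node t -> ~ F t -> \forall n \near U,
  (forall k, k \in t -> (k < n)%N) /\ node (n |` t)%fset.
Proof.
move=> [Tt tM] nFt; have [b bP] := closure_initial_extend spF Tt nFt.
apply: filterS2 UM (Uoo b) => n Mn /bP[tn Tn]; split=> //; split=> //.
by move=> k /=; rewrite !inE => /predU1P[->//|/tM].
Qed.

(** The default value 0 makes this total: the recursion below has to take limits before boundedness
    of its values is known. *)
Definition weak_limit (g : nat -> ell hp) : ell hp :=
  if pselect (exists2 z : ell hp, `|z| <= C & forall k, g n k @[n --> U] --> z k)
    is left h then s2val (cid2 h) else 0.

Lemma weak_limitP (g : nat -> ell hp) : (\forall n \near U, `|g n| <= C) ->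
  `|weak_limit g| <= C /\ forall k, g n k @[n --> U] --> weak_limit g k.
Proof.
move=> gC; rewrite /weak_limit; case: pselect; last first.
  by case; exact: ell_weak_limit gC.
by move=> h; case: cid2 => z.
Qed.

(** The recursive value exists only when adding [n] gives a proper extension inside the tree. At a
    node outside [F] this holds for [U]-almost all [n], so the default 0 does not affect the
    limit. *)
Definition tree_limit_step t (rec : forall t', tree_lt F t' t -> ell hp) : ell hp :=
  if pselect (F t) then x t else
  weak_limit (fun n => if pselect (tree_lt F (n |` t)%fset t) is left h
                       then rec _ h else 0).

Definition tree_limit : {fset nat} -> ell hp :=
  Fix wfF (fun=> ell hp) tree_limit_step.

Lemma tree_limitE t : tree_limit t = if pselect (F t) then x t else
  weak_limit (fun n => if pselect (tree_lt F (n |` t)%fset t)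
                       then tree_limit (n |` t)%fset else 0).
Proof.
rewrite {1}/tree_limit Fix_eq; last first.
  move=> s f g fg; suff -> : f = g by [].
  exact: functional_extensionality_dep (fun u => functional_extensionality_dep (fg u)).
rewrite /tree_limit_step; case: (pselect (F t)) => //= nFt; congr weak_limit.
by apply/funext => n; case: (pselect (tree_lt F (n |` t)%fset t)).
Qed.

Lemma tree_limit_leaf t : F t -> tree_limit t = x t.
Proof. by rewrite tree_limitE; case: pselect. Qed.

Lemma near_tree_lt t : node t -> ~ F t -> \forall n \near U,
  node (n |` t)%fset /\ tree_lt F (n |` t)%fset t.
Proof.
move=> nt nFt; apply: filterS (node_extend nt nFt) => n [tn ntn].
split=> //; split; [exact: nt.1|exact: ntn.1|exact: proper_initial_fsetU1].
Qed.

Lemma tree_limit_bounded t : node t -> `|tree_limit t| <= C.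
Proof.
elim/(well_founded_ind wfF): t => t IH nt; rewrite tree_limitE.
case: pselect => [Ft|nFt]; first by apply: xC => //; case: nt.
set g := fun n => _; apply: (weak_limitP (g := g) _).1.
apply: filterS (near_tree_lt nt nFt) => n [nn tn].
rewrite /g; case: (pselect (tree_lt F (n |` t)%fset t)) => //= _; exact: IH.
Qed.

Lemma tree_limit_cvg t : node t -> ~ F t ->
  forall k, tree_limit (n |` t)%fset k @[n --> U] --> tree_limit t k.
Proof.
move=> nt nFt k; rewrite [tree_limit t]tree_limitE; case: pselect => //= _.
set g := fun n => if pselect (tree_lt F (n |` t)%fset t)
                  then tree_limit (n |` t)%fset else 0.
have gk : g n k @[n --> U] --> weak_limit g k.
  apply: (weak_limitP (g := g) _).2; apply: filterS (near_tree_lt nt nFt) => n [nn tn].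
  rewrite /g; case: (pselect (tree_lt F (n |` t)%fset t)) => //= _.
  exact: tree_limit_bounded.
apply: cvg_trans gk; apply: near_eq_cvg.
apply: filterS (near_tree_lt nt nFt) => n [nn tn].
by rewrite /g; case: (pselect (tree_lt F (n |` t)%fset t)).
Qed.

End weak_limits.
End tree_limits.

(** * Block structure along a sparse sequence *)


Lemma near_all_seq (T : eqType) (U : set_system nat) (l : seq T) (P : T -> nat -> Prop) :
  Filter U -> (forall t, t \in l -> \forall n \near U, P t n) ->
  \forall n \near U, forall t, t \in l -> P t n.
Proof.
move=> FU; elim: l => [|a l IH] lP; first exact: nearW.
have aP : \forall n \near U, P a n by apply: lP; rewrite mem_head.
have {}IH : \forall n \near U, forall t, t \in l -> P t n.
  by apply: IH => t tl; apply: lP; rewrite inE tl orbT.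
by apply: filterS2 aP IH => n an ln t; rewrite inE => /predU1P[->//|/ln].
Qed.

Lemma mkseq_rcons (T : Type) (f : nat -> T) n : mkseq f n.+1 = rcons (mkseq f n) (f n).
Proof. by rewrite /mkseq -addn1 iotaD map_cat cats1. Qed.

Section blocks.
Context (R : realType) (p : R) (hp : 1 <= p).
Context (F : Defs.family) (M : nat -> nat) (x : {fset nat} -> ell hp) (C : R).
Hypothesis thF : thin F.
Hypothesis spF : spreading (closure_initial F).
Hypothesis wfF : well_founded (tree_lt F).
Hypothesis xC : forall s, F s -> [set` s] `<=` range M -> `|x s| <= C.
Local Notation node := (node F M).

Context (U : set_system nat) (UU : UltraFilter U) (UM : U (range M)).
Hypothesis Uoo : forall b, \forall n \near U, (b <= n)%N.
Let y := tree_limit x C wfF U.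

(** Requirements on the next term of the sparse sequence: [L] lists the earlier terms and [N] is
    where the block of the new term starts. Adding [n] to a set of earlier terms may hardly disturb
    the coordinates before that block. *)
Definition admissible (b : nat) (L : seq nat) (N : nat) (e : R) (n : nat) :=
  [/\ (exists i, M i = n), (b <= n)%N, forall k, k \in L -> (k < n)%N &
  forall t : {fset nat}, {subset t <= L} -> node t -> ~ F t ->
    node (n |` t)%fset /\
    `|restr (fun k => (k < N)%N) (y (n |` t)%fset - y t)| <= e].

Lemma fpowerset_seq (L : seq nat) (t : {fset nat}) :
  {subset t <= L} -> t \in fpowerset [fset k in L]%fset.
Proof. by move=> tL; rewrite fpowersetE; apply/fsubsetP => k /tL; rewrite inE. Qed.

(** Only finitely many sets [t] are contained in [L], and for each of them finitely many coordinates
    converge along [U]. *)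
Lemma admissible_ex b L N e : 0 < e -> exists n, admissible b L N e n.
Proof.
move=> e0; suff : \forall n \near U, admissible b L N e n by exact: filter_ex.
have h1 : \forall n \near U, exists i, M i = n.
  by apply: filterS UM => n [i _ <-]; exists i.
have h2 : \forall n \near U, forall k, k \in L -> (k < n)%N.
  by apply: near_all_seq => k _; exact: Uoo.
have h3 : \forall n \near U, forall t,
    t \in (fpowerset [fset k in L]%fset : {fset _}) -> node t -> ~ F t ->
    node (n |` t)%fset /\
    `|restr (fun k => (k < N)%N) (y (n |` t)%fset - y t)| <= e.
  apply: near_all_seq => t _.
  have [nt|nnt] := pselect (node t); last by apply: nearW => n /nnt.
  have [Ft|nFt] := pselect (F t); first by apply: nearW => n _ /(_ Ft).
  have tc := tree_limit_cvg spF xC UU UM Uoo nt nFt.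
  have : (\sum_(k < N) `|(y (n |` t)%fset - y t) k|) @[n --> U] --> \sum_(k < N) (0 : R).
    apply: cvg_big => [|k _]; first exact: add_continuous.
    rewrite -(normr0 R) -(subrr (y t k)).
    by apply: cvg_norm; apply: cvgB; [exact: tc|exact: cvg_cst].
  rewrite big1// => /cvgrPdist_lt/(_ _ e0) h.
  apply: filterS2 h (node_extend spF UU UM Uoo nt nFt) => n /=.
  rewrite sub0r normrN => /ltW he [_ nn] _ _; split=> //.
  apply: le_trans (restr_head _ _) _; apply: le_trans he; exact: ler_norm.
near=> n; split.
- by near: n.
- by near: n; exact: Uoo.
- by near: n.
- by move=> t tL; apply: (near h3 n); rewrite ?fpowerset_seq.
Unshelve. all: by end_near. Qed.

Lemma tail_ex (L : seq nat) N e : 0 < e -> exists n, (N <= n)%N /\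
  forall t : {fset nat}, {subset t <= L} -> `|restr (fun k => (n <= k)%N) (y t)| <= e.
Proof.
move=> e0.
have : \forall n \near \oo, forall t, t \in (fpowerset [fset k in L]%fset : {fset _}) ->
    `|restr (fun k => (n <= k)%N) (y t)| <= e.
  apply: near_all_seq => t _; have [n0 nP] := ell_tail (y t) e0.
  by exists n0 => // n /=; exact: nP.
move=> [n0 _ nP]; exists (maxn N n0); split; first exact: leq_maxl.
by move=> t tL; apply: nP; [exact: leq_maxr|exact: fpowerset_seq].
Qed.

(** Terms and cuts are chosen alternately: first [m i], given the cut [N i], then [N i.+1] so far
    out that all vectors over sets of terms up to [m i] have small tails. *)
Lemma sparse_sequence (b : nat) (e : nat -> R) : (forall i, 0 < e i) ->
  exists m N : nat -> nat, (forall i, (N i <= N i.+1)%N) /\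
    forall i, admissible b (mkseq m i) (N i) (e i) (m i) /\
      forall t : {fset nat}, {subset t <= mkseq m i} ->
        `|restr (fun k => (N i <= k)%N) (y t)| <= e i.
Proof.
move=> e0.
have /choice[f fP] : forall q : seq nat * nat * nat,
    exists n, admissible b q.1.1 q.1.2 (e q.2) n.
  by move=> q; exact: admissible_ex.
have /choice[g gP] : forall q : seq nat * nat * nat, exists n, (q.1.2 <= n)%N /\
    forall t : {fset nat}, {subset t <= q.1.1} ->
      `|restr (fun k => (n <= k)%N) (y t)| <= e q.2.
  by move=> q; exact: tail_ex.
(* The state after [i] steps consists of the list of the first [i] terms and the cut [N i]. *)
pose step i (q : seq nat * nat) :=
  let L := rcons q.1 (f (q, i)) in (L, g (L, q.2, i.+1)).
pose st := fix st i := if i is j.+1 then step j (st j) else ([::], g ([::], 0%N, 0%N)).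
pose m i := f (st i, i).
have stm i : (st i).1 = mkseq m i by elim: i => // i IH; rewrite mkseq_rcons -IH.
exists m, (fun i => (st i).2); split=> [i|i].
  exact: (gP (rcons (st i).1 (f (st i, i)), (st i).2, i.+1)).1.
split; first by rewrite -stm; exact: fP.
case: i => [|i] t; first exact: (gP ([::], 0%N, 0%N)).2.
rewrite -stm => tm.
exact: (gP (rcons (st i).1 (f (st i, i)), (st i).2, i.+1)).2 tm.
Qed.

(* The error at t is at most eps for cutting the vector at the root, plus
   3 eps / 2^(j+1) for each m_j in t: one for the coordinates before the block
   of m_j, two for the tails behind it. *)
Lemma block_structure (b : nat) (eps : R) : 0 < eps ->
  exists (m N : nat -> nat) (w : ell hp),
  [/\ forall i, (N i <= N i.+1)%N, forall i, (b <= m i)%N /\ exists j, M j = m i,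
      {homo m : i j / (i < j)%N} &
  (forall k, (N 0 <= k)%N -> w k = 0) /\
  (forall i (t : {fset nat}), node t -> ~ F t -> {subset t <= mkseq m i} ->
     node (m i |` t)%fset) /\
  forall i (t : {fset nat}), node t -> {subset t <= mkseq m i} ->
    exists v : ell hp,
    (forall k, v k != 0 -> exists j, m j \in t /\ (N j <= k < N j.+1)%N) /\
    `|y t - w - v| <= eps * (4 - 3 / 2 ^+ i)].
Proof.
move=> eps0.
have e0 i : 0 < eps / 2 ^+ i.+1 by rewrite divr_gt0// exprn_gt0.
have [m [N [Nm mP]]] := sparse_sequence b e0.
have mlt i k : k \in mkseq m i -> (k < m i)%N by have [[_ _ + _] _] := mP i; exact.
have mh : {homo m : i j / (i < j)%N}.
  move=> i j ij; apply: mlt; apply/mapP; exists i => //.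
  by rewrite mem_iota.
exists m, N, (restr (fun k => (k < N 0)%N) (y fset0)); split=> //.
  by move=> i; have [[[j Mj] bm _ _] _] := mP i; split=> //; exists j.
split; first by move=> k k0; rewrite restrE ltnNge k0.
split.
  by move=> i t nt nFt tm; have [[_ _ _ /(_ _ tm nt nFt)[? _]] _] := mP i.
elim=> [|i IH] t nt tm.
  have -> : t = fset0 by apply/fsetP => k; rewrite inE; apply/negP => /tm.
  exists 0; split=> [k|]; first by rewrite eqxx.
  have h : `|restr (fun k => (N 0 <= k)%N) (y fset0)| <= eps / 2 ^+ 1.
    by apply: (mP 0%N).2 => k; rewrite inE.
  have -> : y fset0 - restr (fun k => (k < N 0)%N) (y fset0) =
      restr (fun k => (N 0 <= k)%N) (y fset0).
    apply: ell_eqP => k; rewrite ell_evalB !restrE ltnNge.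
    by case: leqP; rewrite ?subr0 ?subrr.
  rewrite subr0; apply: le_trans h _; rewrite expr1 expr0; lra.
have e2 : (2 ^+ i.+1)^-1 = (2 ^+ i)^-1 / 2 :> R by rewrite exprS invfM mulrC.
have q0 : 0 < (2 ^+ i)^-1 :> R by rewrite invr_gt0 exprn_gt0.
(* If [m i] is not in [t], the induction hypothesis applies to [t] itself; otherwise it applies to
   [t] without its largest element [m i]. *)
have [it|nit] := boolP (m i \in t); last first.
  have [|v [vt vn]] := IH t nt.
    move=> k kt; have := tm k kt; rewrite mkseq_rcons mem_rcons inE => /predU1P[E|//].
    by move: nit; rewrite -E kt.
  exists v; split=> //; apply: le_trans vn _; rewrite ler_wpM2l// ?ltW// e2; lra.
set t0 := (t `\ m i)%fset.
have t0m : {subset t0 <= mkseq m i}.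
  move=> k; rewrite !inE => /andP[kn kt].
  by have := tm k kt; rewrite mkseq_rcons mem_rcons inE (negPf kn).
have tE : t = (m i |` t0)%fset by rewrite fsetD1K.
have t0t : proper_initial t0 t.
  by rewrite tE; apply: proper_initial_fsetU1 => k /t0m; exact: mlt.
have nt0 : node t0 by apply: node_initial nt _; case/andP: t0t.
have nFt0 : ~ F t0.
  by move=> Ft0; have := leaf_not_proper thF Ft0 nt.1; rewrite t0t.
have [v0 [v0t v0n]] := IH t0 nt0 t0m.
set z := y t - y t0.
have h1 : `|restr (fun k => (k < N i)%N) z| <= eps / 2 ^+ i.+1.
  by have [[_ _ _ /(_ _ t0m nt0 nFt0)[_ ?]] _] := mP i; rewrite /z tE.
have h2 : `|restr (fun k => (N i.+1 <= k)%N) (y t)| <= eps / 2 ^+ i.+2.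
  exact: (mP i.+1).2.
have h3 : `|restr (fun k => (N i.+1 <= k)%N) (y t0)| <= eps / 2 ^+ i.+2.
  by apply: (mP i.+1).2 => k /t0m kt; rewrite mkseq_rcons mem_rcons inE kt orbT.
(* The new piece is the change from [t0] to [t] on the block of [m i]. Before the block this change
   is small by admissibility; behind it both vectors are small. *)
pose d := restr (fun k => (N i <= k < N i.+1)%N) z.
have zE : z - d = restr (fun k => (k < N i)%N) z +
    (restr (fun k => (N i.+1 <= k)%N) (y t) - restr (fun k => (N i.+1 <= k)%N) (y t0)).
  rewrite -restrB; apply: ell_eqP => k; rewrite ell_evalB ellD !restrE.
  have := Nm i; case: (leqP (N i) k); case: (leqP (N i.+1) k) => /=.
  - by rewrite subr0 add0r.
  - by rewrite subrr addr0.
  - lia.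
  - by rewrite subr0 addr0.
exists (v0 + d); split.
  move=> k; rewrite ellD; have [->|/v0t[j [jt jk]] _] := eqVneq (v0 k) 0; last first.
    by exists j; split=> //; move: jt; rewrite !inE => /andP[].
  by rewrite add0r restrE; case: ifP => [h _|_]; [exists i|rewrite eqxx].
have -> : y t - restr (fun k => (k < N 0)%N) (y fset0) - (v0 + d) =
  (y t0 - restr (fun k => (k < N 0)%N) (y fset0) - v0) + (z - d).
  by rewrite /z; apply: ell_eqP => k; rewrite !(ell_evalB, ellD); ring.
rewrite zE; apply: le_trans (ler_normD _ _) _.
apply: le_trans (lerD v0n (ler_normD _ _)) _.
apply: le_trans (lerD (lexx _) (lerD h1 (ler_normB _ _))) _.
apply: le_trans (lerD (lexx _) (lerD (lexx _) (lerD h2 h3))) _.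
have -> : (2 ^+ i.+2)^-1 = (2 ^+ i)^-1 / 4 :> R.
  by rewrite !exprS !invfM mulrA mulrC; congr (_ * _); lra.
rewrite e2; move: q0; set q := (2 ^+ i)^-1 => q0; nra.
Qed.

End blocks.

(** * Plegma tuples *)


Lemma homo_inj (m : nat -> nat) : {homo m : i j / (i < j)%N} -> injective m.
Proof. by move=> mh i j E; case: (ltngtP i j) => // /mh; rewrite E ltnn. Qed.

Lemma elts_mkseq (g : nat -> nat) r : {homo g : i j / (i < j)%N} ->
  elts [fset x in mkseq g r]%fset = mkseq g r.
Proof.
move=> gh; apply: elts_seq; rewrite /mkseq.
by rewrite (homo_sorted gh)// iota_ltn_sorted.
Qed.

Section plegma_tuples.
Context (F : Defs.family) (M m : nat -> nat).
Hypothesis wfF : well_founded (tree_lt F).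
Hypothesis F0 : closure_initial F fset0.
Hypothesis nF0 : ~ F fset0.
Hypothesis mh : {homo m : i j / (i < j)%N}.
Hypothesis mext : forall i (t : {fset nat}), node F M t -> ~ F t ->
  {subset t <= mkseq m i} -> node F M (m i |` t)%fset.

(** As long as the set built is not in [F], the next term [m (g r)] extends it within the tree;
    well-foundedness ends this, and it can end only in [F]. *)
Lemma branch_ends (g : nat -> nat) : {homo g : i j / (i < j)%N} ->
  exists r, F [fset k in mkseq (m \o g) r]%fset.
Proof.
move=> gh; pose t r := [fset k in mkseq (m \o g) r]%fset.
suff H : forall s r, s = t r -> node F M s -> exists r, F (t r).
  apply: (H _ 0%N erefl); have -> : t 0%N = fset0 by apply/fsetP => k; rewrite !inE.
  by split=> // k /=; rewrite inE.
move=> s; elim/(well_founded_ind wfF): s => s IH r sr ns.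
have [Fs|nFs] := pselect (F s); first by exists r; rewrite -/(t r) -sr.
have tr : t r.+1 = (m (g r) |` s)%fset.
  by apply/fsetP => k; rewrite sr /t mkseq_rcons !inE mem_rcons !inE.
have sm : {subset s <= mkseq m (g r)}.
  move=> k; rewrite sr !inE => /mapP[i]; rewrite mem_iota add0n => ir ->.
  by apply: map_f; rewrite mem_iota /=; apply: gh.
have ns' : node F M (t r.+1) by rewrite tr; exact: mext.
apply: (IH (t r.+1) _ r.+1) => //; split; [exact: ns.1|exact: ns'.1|].
rewrite tr; apply: proper_initial_fsetU1 => k /sm /mapP[i]; rewrite mem_iota /= => ir ->.
exact: mh.
Qed.

Lemma plegma_tuple_ex K : exists s : 'I_K.+1 -> {fset nat},
  [/\ forall j, F (s j), forall j k, k \in s j -> exists i, k = m i, plegma s &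
      forall i j k, k \in s i -> k \in s j -> i = j].
Proof.
(* The [j]-th set follows the indices congruent to [j] modulo [K.+1]. Residues make the sets
   disjoint, and at each rank all of them stay below the elements of the next rank, which gives
   plegma. *)
pose g (j : 'I_K.+1) i := (j + i * K.+1)%N.
have gh j : {homo g j : a b / (a < b)%N}.
  by move=> a b ab; rewrite /g ltn_add2l ltn_pmul2r.
have mgh j : {homo (m \o g j) : a b / (a < b)%N} by move=> a b ab; apply: mh; exact: gh.
have /choice[r rP] : forall j, exists r, F [fset k in mkseq (m \o g j) r]%fset.
  by move=> j; exact: branch_ends.
pose s j := [fset k in mkseq (m \o g j) (r j)]%fset.
have sE j : elts (s j) = mkseq (m \o g j) (r j) by exact: elts_mkseq.
have sr j : #|` s j | = r j by rewrite -size_elts sE size_mkseq.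
have elE j k : (k < r j)%N -> el (s j) k = m (g j k).
  by move=> kr; rewrite /el sE nth_mkseq.
exists s; split=> //.
- by move=> j k; rewrite !inE => /mapP[i _ ->]; exists (g j i).
- split.
  + by move=> j; apply/eqP => sj; apply: nF0; rewrite -sj; exact: rP.
  + by move=> i j k ij; rewrite !sr => ki kj; rewrite !elE//; apply: mh; rewrite ltn_add2r.
  + move=> i j k; rewrite !sr => ki kj; rewrite !elE//; apply: mh; rewrite /g.
    have := ltn_ord i; lia.
- move=> i j k; rewrite !inE => /mapP[a _ ->] /mapP[b _ /(homo_inj mh)].
  rewrite /g => /(congr1 (modn^~ K.+1)).
  rewrite !(addnC (val _)) !modnMDl !modn_small ?ltn_ord//.
  exact: val_inj.
Qed.

End plegma_tuples.

Section plegma_blocks.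
Context (R : realType) (p : R) (hp : 1 <= p).
Context (F : Defs.family) (M : nat -> nat) (x : {fset nat} -> ell hp) (C : R).
Hypothesis Mh : {homo M : m n / (m < n)%N}.
Hypothesis thF : thin F.
Hypothesis spF : spreading (closure_initial F).
Hypothesis wfF : well_founded (tree_lt F).
Hypothesis xC : forall s, F s -> [set` s] `<=` range M -> `|x s| <= C.
Hypothesis F0 : closure_initial F fset0.
Hypothesis nF0 : ~ F fset0.

Lemma plegma_blocks K b (eps : R) : 0 < eps ->
  exists (s : 'I_K.+1 -> {fset nat}) (w : ell hp) (v : 'I_K.+1 -> ell hp),
  [/\ plegma s, forall j, F (s j) /\ [set` s j] `<=` range M,
      forall j, (b <= el (s j) 0)%N,
      (forall j k, w k = 0 \/ v j k = 0) /\
      (forall i j k, i != j -> v i k = 0 \/ v j k = 0) &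
      forall j, `|x (s j) - w - v j| <= eps].
Proof.
(* The error in [block_structure] stays below four times its parameter. *)
move=> eps0; have e4 : 0 < eps / 4 by rewrite divr_gt0.
have [U [UU UM Uoo]] := ultra_on_range Mh.
have [m [N [w [Nm mP mh [w0 [mext mv]]]]]] :=
  block_structure thF spF wfF xC UU UM Uoo b e4.
have [s [Fs sm sp sd]] := plegma_tuple_ex wfF F0 nF0 mh mext K.
have sM j : [set` s j] `<=` range M.
  by move=> k /= /sm[i ->]; have [_ [a Ma]] := mP i; exists a.
have /choice[v vP] : forall j, exists v : ell hp,
    (forall k, v k != 0 -> exists i, m i \in s j /\ (N i <= k < N i.+1)%N) /\
    `|x (s j) - w - v| <= eps.
  (* Since [a <= m a], each element [m a] of [s j] has its index [a] below this [i]. *)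
  move=> j; pose i := (\max_(k <- elts (s j)) k).+1.
  have [||v [vs vn]] := mv i (s j).
  - by split=> //; exact: sub_closure_initial.
  - move=> k ks; have [a ka] := sm _ _ ks; rewrite ka; apply: map_f.
    rewrite mem_iota /= add0n ltnS (leq_trans (homo_geq_id mh a))// -ka.
    by apply: leq_bigmax_seq => //; rewrite mem_elts.
  exists v; split=> //; move: vn; rewrite tree_limit_leaf// => /le_trans; apply.
  rewrite [leRHS](_ : eps = eps / 4 * 4); last by rewrite divfK.
  rewrite ler_wpM2l ?(ltW e4)//.
  have : 0 < (2 ^+ i)^-1 :> R by rewrite invr_gt0 exprn_gt0.
  lra.
have Nmono : {homo N : a b / (a <= b)%N} by apply: homo_leq => //; exact: leq_trans.
exists s, w, v; split=> //.
- move=> j; have : el (s j) 0 \in s j.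
    rewrite -mem_elts; apply: mem_nth; rewrite size_elts cardfs_gt0.
    by have [+ _ _] := sp; exact.
  by move=> /sm[i ->]; have [] := mP i.
- split=> [j k|i j k ij].
    have [vk|/(vP j).1[a [_ /andP[Nak _]]]] := eqVneq (v j k) 0; first by right.
    by left; apply: w0; apply: leq_trans Nak; exact: Nmono.
  have [vi|/(vP i).1[a [ai /andP[a1 a2]]]] := eqVneq (v i k) 0; first by left.
  have [vj|/(vP j).1[c [cj /andP[c1 c2]]]] := eqVneq (v j k) 0; first by right.
  have [ac|ca|ac] := ltngtP a c.
  + by have := Nmono _ _ ac; rewrite leqNgt (leq_ltn_trans c1 a2).
  + by have := Nmono _ _ ca; rewrite leqNgt (leq_ltn_trans a1 c2).
  + by move: ij; rewrite (sd i j (m a)) ?eqxx// ac.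
- by move=> j; exact: (vP j).2.
Qed.

End plegma_blocks.

(** * The norm of a spreading model *)


Lemma ell_norm_sum_disjoint (R : realType) (p : R) (hp : 1 <= p) (I : eqType)
    (r : seq I) (f : I -> ell hp) : uniq r ->
  (forall i j k, i != j -> f i k = 0 \/ f j k = 0) ->
  `|\sum_(i <- r) f i| `^ p = \sum_(i <- r) `|f i| `^ p.
Proof.
move=> + fd; elim: r => [_|i r IH /= /andP[ir ur]].
  by rewrite !big_nil normr0 powR0// gt_eqF// (lt_le_trans ltr01).
rewrite !big_cons ell_norm_disjoint ?IH// => k.
have [fik|fik] := eqVneq (f i k) 0; [by left|right].
elim: r ir {ur IH} => [|j r IH]; first by rewrite big_nil.
rewrite inE negb_or big_cons ellD => /andP[ij /IH ->]; rewrite addr0.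
by case: (fd i j k ij) => // /eqP; rewrite (negPf fik).
Qed.

Lemma ell_norm_block_comb (R : realType) (p : R) (hp : 1 <= p) (n : nat)
    (w : ell hp) (v : 'I_n -> ell hp) (c : R) (a : 'I_n -> R) :
  (forall j k, w k = 0 \/ v j k = 0) ->
  (forall i j k, i != j -> v i k = 0 \/ v j k = 0) ->
  `|c *: w + \sum_j a j *: v j| `^ p =
  `|c| `^ p * `|w| `^ p + \sum_j `|a j| `^ p * `|v j| `^ p.
Proof.
move=> wv vv; rewrite ell_norm_disjoint; last first.
  move=> k; rewrite ellZ; have [->|wk] := eqVneq (w k) 0; [by left; rewrite mulr0|right].
  elim/big_ind : _ => [//|x y x0 y0|j _]; first by rewrite ellD x0 y0 addr0.
  by rewrite ellZ; case: (wv j k) => [/eqP|->]; rewrite ?(negPf wk) ?mulr0.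
rewrite ell_norm_sum_disjoint ?index_enum_uniq//; last first.
  by move=> i j k ij; rewrite !ellZ; case: (vv i j k ij) => ->; [left|right]; rewrite mulr0.
rewrite normrZ powRM//; congr (_ + _); apply: eq_bigr => j _.
by rewrite normrZ powRM.
Qed.

Lemma sum_delta (R : pzRingType) (V : lmodType R) (I : finType) (j : I) (v : I -> V) :
  \sum_i (i == j)%:R *: v i = v j.
Proof.
rewrite (bigD1 j)//= eqxx scale1r big1 ?addr0// => i /negPf ->.
by rewrite scale0r.
Qed.

Lemma bounded_dist_cvg (R : realType) (f g : nat -> R) (l : R) :
  (forall n, `|l - f n| <= g n) -> g @ \oo --> 0 -> f @ \oo --> l.
Proof.
move=> fg /cvgrPdist_lt g0; apply/cvgrPdist_lt => r /g0; apply: filterS => n.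
rewrite sub0r normrN; apply: le_lt_trans; apply: le_trans (fg n) _; exact: ler_norm.
Qed.

Lemma cvg_ext (R : realType) (f g : nat -> R) (l : R) :
  (forall n, f n = g n) -> g @ \oo --> l -> f @ \oo --> l.
Proof. by move=> /funext ->. Qed.

Section formula.
Context (R : realType) (p : R) (hp : 1 <= p).
Context (V : lmodType R) (nu : seminorm V) (e : nat -> V).
Context (F : Defs.family) (M : nat -> nat) (x : {fset nat} -> ell hp).
Hypothesis Mh : {homo M : m n / (m < n)%N}.
Hypothesis thF : thin F.
Hypothesis spF : spreading (closure_initial F).
Hypothesis wfF : well_founded (tree_lt F).
Hypothesis F0 : closure_initial F fset0.
Hypothesis nF0 : ~ F fset0.
Hypothesis gen : generates F M x nu e.
Let p_gt0 : 0 < p := lt_le_trans ltr01 hp.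

Lemma plegma1 (s : {fset nat}) : s != fset0 -> plegma (fun _ : 'I_1 => s).
Proof.
move=> s0; split=> // [i j k|_ _ k _ ks]; first by rewrite !ord1.
have := sorted_elts s; rewrite /el => /(sorted_ltn_nth ltn_trans 0%N); apply=> //.
- by rewrite inE size_elts ltnW.
- by rewrite inE size_elts.
Qed.

Lemma generates_singleton (d : nat -> R) (s : {fset nat}) l :
  (forall k l, (k <= l)%N ->
    forall s : 'I_k.+1 -> {fset nat},
      (forall j, F (s j) /\ [set` s j] `<=` range M) -> plegma s ->
      (M l <= el (s ord0) 0)%N ->
    forall a : 'I_k.+1 -> R, (forall j, -1 <= a j <= 1) ->
      `| `|\sum_(j < k.+1) a j *: x (s j)| -
         nu (\sum_(j < k.+1) a j *: e j) | <= d l) ->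
  F s -> [set` s] `<=` range M -> (M l <= el s 0)%N ->
  `| `|x s| - nu (e 0) | <= d l.
Proof.
move=> dP Fs sM Ml.
have s0 : s != fset0 by apply/eqP => E; apply: nF0; rewrite -E.
have := dP 0%N l (leq0n l) (fun=> s) (fun=> conj Fs sM) (plegma1 s0) Ml (fun=> 1).
by rewrite !big_ord1 !scale1r; apply=> _; apply/andP; split; lra.
Qed.

(** A single nonempty set is a plegma tuple, and if it lies in the range of [M] it starts at [M 0]
    or later, so the estimate with [l = 0] covers every [s]. *)
Lemma generated_bounded : exists C : R,
  forall s, F s -> [set` s] `<=` range M -> `|x s| <= C.
Proof.
have [d [_ _ dP]] := gen; exists (nu (e 0) + d 0%N) => s Fs sM.
rewrite -lerBlDl; apply: le_trans (ler_norm _) _.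
apply: (generates_singleton dP) => //.
have : el s 0 \in s.
  rewrite -mem_elts; apply: mem_nth; rewrite size_elts cardfs_gt0.
  by apply/eqP => E; apply: nF0; rewrite -E.
by move=> /sM[[|i] _ <-] //; rewrite ltnW// Mh.
Qed.

(** The coefficients are the p-th powers of the norms of the root vector and of the block parts, for
    plegma tuples with errors tending to 0. So far only their combinations are known to converge.
    The values at all [e j] agree because each member of a tuple is by itself a plegma tuple of
    length one. *)
Lemma block_limits K : exists (al : nat -> R) (be : 'I_K.+1 -> nat -> R),
  [/\ forall n, 0 <= al n,
      forall a : 'I_K.+1 -> R, (forall j, -1 <= a j <= 1) ->
        `|\sum_j a j| `^ p * al n + \sum_j `|a j| `^ p * be j n @[n --> \oo]
          --> nu (\sum_j a j *: e j) `^ p &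
      forall j : 'I_K.+1, nu (e j) = nu (e 0)].
Proof.
have [C xC] := generated_bounded; have [d [d0 dl dP]] := gen.
(* The maximum allows tuples of [K.+1] sets for every [n], while [d (l n)] still tends to 0. *)
pose l n := maxn n K; pose eps n : R := n.+1%:R^-1.
have e0 n : 0 < eps n by rewrite invr_gt0.
have /choice[s] := fun n => plegma_blocks Mh thF spF wfF xC F0 nF0 K (M (l n)) (e0 n).
move=> /choice[w /choice[v sP]].
have sgen n (a : 'I_K.+1 -> R) : (forall j, -1 <= a j <= 1) ->
    `| `|\sum_j a j *: x (s n j)| - nu (\sum_j a j *: e j) | <= d (l n).
  by move=> a1; have [ps Fs sb _ _] := sP n; apply: dP => //; exact: leq_maxr.
have dl0 : d (l n) @[n --> \oo] --> 0.
  apply/cvgrPdist_lt => r r0; have /cvgrPdist_lt/(_ _ r0)[N _ NP] := dl.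
  by exists N => // n /= Nn; apply: NP; rewrite /= (leq_trans Nn)// leq_maxl.
have eps0 : eps n @[n --> \oo] --> 0 by exact: cvg_harmonic.
exists (fun n => `|w n| `^ p), (fun j n => `|v n j| `^ p); split.
- by move=> n; exact: powR_ge0.
- move=> a a1; pose z n := (\sum_j a j) *: w n + \sum_j a j *: v n j.
  have zE n : `|\sum_j a j| `^ p * `|w n| `^ p + \sum_j `|a j| `^ p * `|v n j| `^ p =
      `| `|z n| | `^ p.
    by have [_ _ _ [wv vv] _] := sP n; rewrite normr_id /z ell_norm_block_comb.
  under eq_cvg do rewrite zE.
  rewrite -[nu _]ger0_norm ?seminorm_ge0//.
  apply: (continuous_cvg _ (@norm_powR_continuous _ _ p_gt0 _)).
  have zn n : `|nu (\sum_j a j *: e j) - `|z n| | <= d (l n) + K.+1%:R * eps n.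
    have [_ _ _ _ sb] := sP n.
    have h : `|\sum_j a j *: x (s n j) - z n| <= K.+1%:R * eps n.
      have -> : \sum_j a j *: x (s n j) - z n = \sum_j a j *: (x (s n j) - w n - v n j).
        rewrite /z scaler_suml opprD addrA -!sumrB; apply: eq_bigr => j _.
        by rewrite !scalerBr.
      apply: le_trans (ler_norm_sum _ _ _) _.
      apply: le_trans (_ : \sum_(j < K.+1) eps n <= _); last first.
        by rewrite sumr_const card_ord mulr_natl.
      apply: ler_sum => j _; rewrite normrZ -[leRHS]mul1r ler_pM//.
      by rewrite ler_norml; exact: a1.
    apply: le_trans (ler_distD `|\sum_j a j *: x (s n j)| _ _) _.
    rewrite [leLHS](_ : _ = `| `|\sum_j a j *: x (s n j)| - nu (\sum_j a j *: e j) | +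
      `| `|\sum_j a j *: x (s n j)| - `|z n| |); last by rewrite distrC.
    apply: lerD; first exact: sgen.
    exact: le_trans (ler_dist_dist _ _) h.
  apply: (bounded_dist_cvg zn); rewrite -[X in _ --> X](addr0 0); apply: cvgD => //.
  by rewrite -[X in _ --> X](mulr0 K.+1%:R); apply: cvgM => //; exact: cvg_cst.
- move=> j; apply/eqP; rewrite -subr_eq0 -normr_le0.
  have d2 : d (l n) + d (l n) @[n --> \oo] --> (0 : R).
    by rewrite -[X in _ --> X](addr0 0); exact: cvgD.
  apply: cvgr_to_ge d2 _; apply: nearW => n.
  have [ps Fs sb _ _] := sP n; have [Fsj sMj] := Fs j.
  have := generates_singleton dP Fsj sMj (sb j).
  have d1 i : -1 <= ((i == j)%:R : R) <= 1 by case: (i == j) => /=; lra.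
  have := sgen n _ d1; rewrite (sum_delta j (fun i => x (s n i))) (sum_delta j (fun i => e i)).
  move=> h1 h2; apply: le_trans (ler_distD `|x (s n j)| _ _) _.
  by rewrite lerD// distrC.
Qed.


(** The explicit values of [A] and [B] show that they do not depend on [K]. They come from testing
    [block_limits] on unit vectors and on a difference of two; [K.+2] guarantees two indices. *)
Lemma formula_unit_ball K : exists A B : R, [/\ 0 <= A, 0 <= B,
    A = nu (e 0) `^ p - nu (e 0 - e 1) `^ p / 2, B = nu (e 0 - e 1) `^ p / 2 &
    forall a : 'I_K.+2 -> R, (forall j, -1 <= a j <= 1) ->
      nu (\sum_j a j *: e j) `^ p =
        A * `|\sum_j a j| `^ p + B * \sum_j `|a j| `^ p].
Proof.
have [al [be [al0 lim ej]]] := block_limits K.+1.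
have powb (b : bool) : `|b%:R : R| `^ p = b%:R.
  by case: b; rewrite ?normr1 ?powR1// normr0 powR0// gt_eqF.
have b1 (b : bool) : -1 <= (b%:R : R) <= 1 by case: b => /=; lra.
have d1 (j i : 'I_K.+2) : -1 <= ((i == j)%:R : R) <= 1 by exact: b1.
have sd (j : 'I_K.+2) (f : 'I_K.+2 -> R) : \sum_i (i == j)%:R * f i = f j.
  exact: (sum_delta j (f : 'I_K.+2 -> R^o)).
have sd1 (j : 'I_K.+2) : \sum_(i < K.+2) (i == j)%:R = 1 :> R.
  by rewrite -[RHS](sd j (fun=> 1)); under [RHS]eq_bigr do rewrite mulr1.
set f0 := nu (e 0) `^ p; set f1 := nu (e 0 - e 1) `^ p.
have alb (j : 'I_K.+2) : al n + be j n @[n --> \oo] --> f0.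
  have := lim _ (d1 j); rewrite (sum_delta j (fun i : 'I_K.+2 => e i)) ej -/f0.
  rewrite sd1 normr1 powR1; under eq_cvg => n.
    rewrite mul1r (eq_bigr (fun i => (i == j)%:R * be i n)); last by move=> i _; rewrite powb.
    rewrite sd; over.
  by [].
pose i0 : 'I_K.+2 := ord0; pose i1 : 'I_K.+2 := lift ord0 ord0.
have i01 : i0 != i1 by [].
have b01 : be i0 n + be i1 n @[n --> \oo] --> f1.
  (* The coefficients of [e 0 - e 1] sum to 0, which removes [al] and isolates the two block
     terms. *)
  pose a (i : 'I_K.+2) : R := (i == i0)%:R - (i == i1)%:R.
  have aP i : `|a i| `^ p = (i == i0)%:R + (i == i1)%:R.
    rewrite /a; have [->|ne0] := eqVneq i i0.
      by rewrite (negPf i01) subr0 addr0 normr1 powR1.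
    by rewrite sub0r normrN powb add0r.
  have a1 i : -1 <= a i <= 1.
    by rewrite /a; case: (i == i0); case: (i == i1) => /=; lra.
  have := lim a a1; rewrite sumrB !sd1 subrr normr0 powR0 ?gt_eqF//.
  have -> : \sum_j a j *: e j = e 0 - e 1.
    rewrite -(sum_delta i0 (fun i : 'I_K.+2 => e i)).
    rewrite -[X in _ - X](sum_delta i1 (fun i : 'I_K.+2 => e i)).
    by rewrite -sumrB; apply: eq_bigr => i _; rewrite scalerBl.
  under eq_cvg => n.
    rewrite mul0r add0r.
    rewrite (eq_bigr (fun i => (i == i0)%:R * be i n + (i == i1)%:R * be i n)); last first.
      by move=> i _; rewrite aP mulrDl.
    rewrite big_split/= !sd; over.
  by [].
(* The two block terms have the same limit: their sum tends to [f1], and their difference tends to 0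
   by [alb]. The remaining limits follow by subtraction. *)
have be0 : be i0 n @[n --> \oo] --> f1 / 2.
  have h : (be i0 n + be i1 n + ((al n + be i0 n) - (al n + be i1 n))) * 2^-1 @[n --> \oo]
      --> (f1 + (f0 - f0)) * 2^-1.
    by apply: cvgM; [apply: cvgD => //; exact: cvgB|exact: cvg_cst].
  move: h; rewrite subrr addr0 => h; apply: (cvg_ext _ h) => n; lra.
have alA : al n @[n --> \oo] --> f0 - f1 / 2.
  have h : (al n + be i0 n) - be i0 n @[n --> \oo] --> f0 - f1 / 2 by exact: cvgB.
  by apply: (cvg_ext _ h) => n; rewrite addrK.
have beB j : be j n @[n --> \oo] --> f1 / 2.
  have h : (al n + be j n) - al n @[n --> \oo] --> f0 - (f0 - f1 / 2) by exact: cvgB.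
  by move: h; rewrite subKr => h; apply: (cvg_ext _ h) => n; rewrite addrC addKr.
exists (f0 - f1 / 2), (f1 / 2); split=> //.
- by apply: cvgr_to_ge alA _; apply: nearW.
- by rewrite divr_ge0// powR_ge0.
move=> a a1.
have h : `|\sum_j a j| `^ p * al n + \sum_j `|a j| `^ p * be j n @[n --> \oo] -->
    `|\sum_j a j| `^ p * (f0 - f1 / 2) + \sum_j `|a j| `^ p * (f1 / 2).
  apply: cvgD; first by apply: cvgM => //; exact: cvg_cst.
  apply: cvg_big => [|j _]; first exact: add_continuous.
  by apply: cvgM => //; exact: cvg_cst.
rewrite (cvg_unique _ (lim a a1) h); last exact: Rhausdorff.
by rewrite [X in X + _]mulrC -mulr_suml [X in _ + X]mulrC.
Qed.

Lemma spreading_model_formula : exists A B : R, [/\ 0 <= A, 0 <= B &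
    forall n (a : nat -> R), nu (\sum_(j < n) a j *: e j) `^ p =
        A * `|\sum_(j < n) a j| `^ p + B * \sum_(j < n) `|a j| `^ p].
Proof.
have [A [B [A0 B0 AE BE _]]] := formula_unit_ball 0.
exists A, B; split=> // n a.
(* Padding by zeros supplies the two or more indices that [formula_unit_ball] works with. *)
pose a' j := if (j < n)%N then a j else 0.
have aa' (W : nmodType) (g : R -> nat -> W) : (forall j, g 0 j = 0) ->
    \sum_(j < n) g (a j) j = \sum_(j < n.+2) g (a' j) j.
  move=> g0; rewrite !big_ord_recr/= /a' ltnn ltnNge leqnSn/= !g0 !addr0.
  by apply: eq_bigr => j _; rewrite ltn_ord.
rewrite (aa' _ (fun r j => r *: e j)); last by move=> j; rewrite scale0r.
rewrite (aa' _ (fun r j => r))// (aa' _ (fun r j => `|r| `^ p)); last first.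
  by move=> j; rewrite normr0 powR0// gt_eqF.
have [A' [B' [_ _ ]]] := formula_unit_ball n.
rewrite -AE -BE => -> -> h {A' B'}.
(* Dividing by [t] brings all coefficients into [[-1, 1]], and both sides are homogeneous of degree
   [p]. The summand 1 keeps [t] positive. *)
pose t : R := 1 + \sum_(j < n.+2) `|a' j|.
have t0 : 0 < t by rewrite ltr_wpDr// sumr_ge0.
have tE r : r = t * (r / t) by rewrite mulrC divfK// gt_eqF.
have at1 (j : 'I_n.+2) : -1 <= a' j / t <= 1.
  rewrite -ler_norml normrM normfV (gtr0_norm t0) ler_pdivrMr// mul1r.
  by rewrite /t (bigD1 j)//= addrCA lerDl addr_ge0// sumr_ge0.
have -> : \sum_(j < n.+2) a' j *: e j = t *: \sum_(j < n.+2) (a' j / t) *: e j.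
  by rewrite scaler_sumr; apply: eq_bigr => j _; rewrite scalerA -tE.
have -> : \sum_(j < n.+2) a' j = t * \sum_(j < n.+2) (a' j / t).
  by rewrite mulr_sumr; apply: eq_bigr => j _; rewrite -tE.
have -> : \sum_(j < n.+2) `|a' j| `^ p = t `^ p * \sum_(j < n.+2) `|a' j / t| `^ p.
  rewrite mulr_sumr; apply: eq_bigr => j _.
  by rewrite {1}(tE (a' j)) normrM (gtr0_norm t0) powRM// ltW.
rewrite seminormZ (gtr0_norm t0) powRM ?seminorm_ge0 ?ltW// h//.
by rewrite normrM (gtr0_norm t0) powRM ?(ltW t0)// mulrDr !(mulrCA (t `^ p)).
Qed.

End formula.

(** * Isometric sequences *)


Lemma ord_funE (T : Type) (t0 : T) n (a : 'I_n -> T) :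
  exists a' : nat -> T, forall j, a j = a' j.
Proof. by exists (fun k => oapp a t0 (insub k)) => j; rewrite valK. Qed.

Section lincomb.
Context (R : realType) (W : lmodType R) (v : nat -> W).
Implicit Types c d : {poly R}.

(* Polynomials serve as the coefficient sequences with finite support. *)
Definition lincomb c : W := \sum_(j < size c) c`_j *: v j.

Lemma lincomb_widen c n : (size c <= n)%N -> lincomb c = \sum_(j < n) c`_j *: v j.
Proof.
move=> cn; rewrite /lincomb (big_ord_widen _ (fun j => c`_j *: v j) cn).
rewrite big_mkcond/=; apply: eq_bigr => j _; case: ltnP => // jc.
by rewrite nth_default// scale0r.
Qed.

Lemma lincombP (a : R) c d : lincomb (a *: c + d) = a *: lincomb c + lincomb d.
Proof.
pose n := maxn (size (a *: c + d)) (maxn (size c) (size d)).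
rewrite (@lincomb_widen _ n) ?leq_maxl// (@lincomb_widen c n) ?(@lincomb_widen d n).
- rewrite scaler_sumr -big_split; apply: eq_bigr => j _ /=.
  by rewrite coefD coefZ scalerDl scalerA.
- by rewrite /n; lia.
- by rewrite /n; lia.
Qed.

Lemma lincomb_poly n (a : nat -> R) :
  lincomb (\poly_(j < n) a j) = \sum_(j < n) a j *: v j.
Proof.
rewrite (@lincomb_widen _ n) ?size_poly//.
by apply: eq_bigr => j _; rewrite coef_poly ltn_ord.
Qed.

End lincomb.

Section approximation.
Context (R : realType) (W : normedModType R) (v : nat -> W).

(** Membership in the closed linear span of [v]. *)
Definition approximable (y : W) : Prop :=
  forall eps : R, 0 < eps -> exists c : {poly R}, `|y - lincomb v c| < eps.

Lemma approximable_lin (a : R) y z :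
  approximable y -> approximable z -> approximable (a *: y + z).
Proof.
move=> ay az r r0; have d0 : 0 < r / 2 / (`|a| + 1) by rewrite !divr_gt0// ltr_wpDl.
have [c cy] := ay _ d0; have [d dz] := az _ (divr_gt0 r0 (ltr0n R 2)).
exists (a *: c + d); rewrite lincombP opprD addrACA -scalerBr.
apply: le_lt_trans (ler_normD _ _) _; rewrite normrZ [ltRHS](splitr r) ler_ltD//.
have := ltW cy; rewrite ler_pdivlMr ?ltr_wpDl// mulrC; apply: le_trans.
by rewrite ler_wpM2r// lerDl.
Qed.

Lemma approximable_lincomb c : approximable (lincomb v c).
Proof. by move=> r r0; exists c; rewrite subrr normr0. Qed.

Lemma approximable_elt j : approximable (v j).
Proof.
have -> : v j = lincomb v 'X^j.
  rewrite (@lincomb_widen _ _ _ _ j.+1) ?size_polyXn// big_ord_recr/= coefXn eqxx scale1r.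
  by rewrite big1 ?add0r// => i _; rewrite coefXn ltn_eqF// scale0r.
exact: approximable_lincomb.
Qed.

Lemma approximable0 : approximable 0.
Proof. by move=> r r0; exists 0; rewrite /lincomb size_poly0 big_ord0 subrr normr0. Qed.

Lemma approximableZ (a : R) y : approximable y -> approximable (a *: y).
Proof.
move=> ay; rewrite -[_ *: _]addr0; apply: approximable_lin => //.
exact: approximable0.
Qed.

Lemma approximableB y z : approximable y -> approximable z -> approximable (y - z).
Proof. by move=> ay az; rewrite addrC -scaleN1r; exact: approximable_lin. Qed.

Lemma approximable_sum n (f : nat -> W) :
  (forall j, approximable (f j)) -> approximable (\sum_(j < n) f j).
Proof.
move=> af; elim: n => [|n IH]; first by rewrite big_ord0; exact: approximable0.
by rewrite big_ord_recr/= addrC -[f n]scale1r; exact: approximable_lin.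
Qed.

Lemma approximable_closure y :
  (forall r, 0 < r -> exists2 z, approximable z & `|y - z| < r) -> approximable y.
Proof.
move=> h r r0; have r2 : 0 < r / 2 by rewrite divr_gt0.
have [z az yz] := h _ r2; have [c zc] := az _ r2; exists c.
by rewrite [ltRHS](splitr r); apply: le_lt_trans (ler_distD z _ _) _; rewrite ltrD.
Qed.

End approximation.

Section transfer.
Context (R : realType) (E H : completeNormedModType R) (u : nat -> E) (v : nat -> H).
Hypothesis uv : forall c : {poly R}, `|lincomb u c| = `|lincomb v c|.

(* The graph of the isometry between the closed spans that maps u to v. *)
Definition linked (x : E) (y : H) : Prop := forall eps : R, 0 < eps ->
  exists c : {poly R}, `|x - lincomb u c| < eps /\ `|y - lincomb v c| < eps.

Lemma linked_lincomb c : linked (lincomb u c) (lincomb v c).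
Proof. by move=> r r0; exists c; rewrite !subrr !normr0. Qed.

Lemma linked_norm x y : linked x y -> `|x| = `|y|.
Proof.
move=> xy; apply/eqP; rewrite -subr_eq0 -normr_le0 leNgt; apply/negP => d0.
have [c [xc yc]] := xy _ (divr_gt0 d0 (ltr0n R 2)).
have := ler_distD `|lincomb u c| `|x| `|y|.
have := ler_dist_dist x (lincomb u c); have := ler_dist_dist (lincomb v c) y.
rewrite -uv (distrC _ y); lra.
Qed.

Lemma linked_lin (a : R) x y x' y' : linked x y -> linked x' y' ->
  linked (a *: x + x') (a *: y + y').
Proof.
move=> xy xy' r r0; have d0 : 0 < r / 2 / (`|a| + 1) by rewrite !divr_gt0// ltr_wpDl.
have [c [xc yc]] := xy _ d0; have [d [xd yd]] := xy' _ (divr_gt0 r0 (ltr0n R 2)).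
have aux (W : normedModType R) (z z' t t' : W) : `|z - t| < r / 2 / (`|a| + 1) ->
    `|z' - t'| < r / 2 -> `|a *: z + z' - (a *: t + t')| < r.
  move=> h h'; rewrite opprD addrACA -scalerBr.
  apply: le_lt_trans (ler_normD _ _) _; rewrite normrZ [ltRHS](splitr r) ler_ltD//.
  have := ltW h; rewrite ler_pdivlMr ?ltr_wpDl// mulrC; apply: le_trans.
  by rewrite ler_wpM2r// lerDl.
by exists (a *: c + d); rewrite !lincombP; split; exact: aux.
Qed.

Lemma linked_sub x y x' y' : linked x y -> linked x' y' -> linked (x - x') (y - y').
Proof.
have D (W : lmodType R) (z z' : W) : z - z' = - 1 *: z' + z.
  by rewrite scaleN1r addrC.
by move=> xy xy'; rewrite !D; exact: linked_lin.
Qed.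

Lemma linked_inj x y y' : linked x y -> linked x y' -> y = y'.
Proof.
move=> xy xy'; have /linked_norm := linked_sub xy xy'.
by rewrite subrr normr0 => /esym/normr0_eq0/eqP; rewrite subr_eq0 => /eqP.
Qed.

(** Combinations of [u] converging to [x] have as counterparts combinations of [v] with the same
    mutual distances; these are Cauchy, and their limit is the partner of [x]. *)
Lemma linked_ex x : approximable u x -> exists y, linked x y.
Proof.
move=> ax.
have e_ n : 0 < n.+1%:R^-1 :> R by rewrite invr_gt0.
have /choice[c cP] := fun n => ax _ (e_ n).
have cc : cvgn (fun n => lincomb v (c n)).
  apply: cauchy_cvg; apply/cauchy_ballP => r r0; rewrite !near_map2.
  have [N /= _ NP] := near_infty_natSinv_lt (PosNum (divr_gt0 r0 (ltr0n R 2))).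
  exists ([set n | (N <= n)%N], [set n | (N <= n)%N]).
    by split; apply: nbhs_infty_ge.
  move=> [m n] [/= Nm Nn]; rewrite -ball_normE/=.
  have -> : lincomb v (c m) - lincomb v (c n) = lincomb v (- 1 *: c n + c m).
    by rewrite lincombP scaleN1r addrC.
  rewrite -uv lincombP scaleN1r addrC.
  apply: le_lt_trans (ler_distD x _ _) _; rewrite distrC [ltRHS](splitr r).
  by apply: ltrD; [exact: lt_trans (cP m) (NP m Nm)|exact: lt_trans (cP n) (NP n Nn)].
exists (lim ((fun n => lincomb v (c n)) @ \oo)) => r r0.
have /cvgrPdist_lt/(_ _ r0) h1 := cc.
have [n [h2 h3]] := filter_ex (filterI h1 (near_infty_natSinv_lt (PosNum r0))).
by exists (c n); split=> //; exact: lt_trans (cP n) h3.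
Qed.

End transfer.

(** * Realization in ell^p *)


Lemma linked_sym (R : realType) (E H : completeNormedModType R) (u : nat -> E)
    (v : nat -> H) x y : linked u v x y -> linked v u y x.
Proof. by move=> xy r /xy[c [xc yc]]; exists c. Qed.

Lemma completion_approximable (R : realType) (V : lmodType R) (nu : seminorm V)
    (e : nat -> V) (x : completion nu) : hamel_basis e ->
  approximable (fun j => completion_in nu (e j)) x.
Proof.
move=> [_ he] r r0; have [v xv] := completion_in_dense x r0.
have : lin_span e v by rewrite he.
move=> [n [a vE]]; have [a' aE] := ord_funE 0 a.
exists (\poly_(j < n) a' j); rewrite lincomb_poly.
suff <- : completion_in nu v = \sum_(j < n) a' j *: completion_in nu (e j) by [].
by rewrite vE linear_sum; apply: eq_bigr => j _; rewrite linearZ aE.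
Qed.

Lemma completion_in_sum (R : realType) (V : lmodType R) (nu : seminorm V)
    (e : nat -> V) n (a : nat -> R) :
  \sum_(j < n) a j *: completion_in nu (e j) = completion_in nu (\sum_(j < n) a j *: e j).
Proof. by rewrite linear_sum; apply: eq_bigr => j _; rewrite linearZ. Qed.

(** The relation [linked] is the graph of the isometry: it is total because [e] spans a dense
    subspace of the completion, and onto by the symmetric argument for [v]. *)
Lemma completion_isometric (R : realType) (V : lmodType R) (nu : seminorm V)
    (e : nat -> V) (G : completeNormedModType R) (v : nat -> G) : hamel_basis e ->
  (forall n (a : nat -> R), nu (\sum_(j < n) a j *: e j) = `|\sum_(j < n) a j *: v j|) ->
  (forall y, approximable v y) -> isometric_spaces (completion nu) G.
Proof.
move=> he ev av; pose u j := completion_in nu (e j).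
have uv c : `|lincomb u c| = `|lincomb v c|.
  by rewrite /lincomb completion_in_sum completion_in_norm ev.
have vu c : `|lincomb v c| = `|lincomb u c| by [].
have /choice[T TP] := fun x => linked_ex uv (completion_approximable x he).
have Tlin : linear T.
  move=> a x y; apply: (linked_inj uv (TP _)).
  exact: linked_lin (TP x) (TP y).
pose T' : {linear completion nu -> G} :=
  HB.pack T (GRing.isLinear.Build R (completion nu) G *:%R T Tlin).
exists T'; split=> [x|y]; first by rewrite -(linked_norm uv (TP x)).
have [x /linked_sym yx] := linked_ex vu (av y).
by exists x; exact: (linked_inj uv (TP x) yx).
Qed.

Section ell_basis_theory.
Context (R : realType) (p : R) (hp : 1 <= p).
Let p_gt0 : 0 < p := lt_le_trans ltr01 hp.
Local Notation b := (ell_basis hp).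

Lemma ell_basis_norm k : `|b k| = 1.
Proof.
apply/le_anti/andP; split; first by rewrite /ell_basis; case: cid2.
by have := ell_coord_le (b k) k; rewrite ell_basisE eqxx normr1.
Qed.

Lemma ell_approximable (v : nat -> ell hp) :
  (forall k, approximable v (b k)) -> forall y, approximable v y.
Proof.
move=> vb y; apply: approximable_closure => r r0.
have [N NP] := ell_tail y (divr_gt0 r0 (ltr0n R 2)).
exists (\sum_(k < N) y k *: b k).
  by apply: (@approximable_sum _ _ v N (fun k => y k *: b k)) => k; exact: approximableZ.
have -> : y - \sum_(k < N) y k *: b k = restr (fun k => (N <= k)%N) y.
  apply: ell_eqP => m; rewrite ell_evalB (ell_eval_sum N (fun k => y k *: b k)) restrE.
  under eq_bigr do rewrite ellZ ell_basisE.
  case: leqP => mN.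
    by rewrite big1 ?subr0// => i _; rewrite gtn_eqF ?mulr0// (leq_trans _ mN).
  rewrite (bigD1 (Ordinal mN))//= eqxx mulr1 big1 ?addr0 ?subrr// => i.
  by rewrite -val_eqE eq_sym /= => /negPf ->; rewrite mulr0.
by apply: le_lt_trans (NP N _) _ => //; lra.
Qed.

(* In this sequence of ell^p the spreading models of ell^p are realized. *)
Definition model (al be : R) (j : nat) : ell hp := al *: b 0 + be *: b j.+1.

Lemma model_sum al be n (a : nat -> R) : \sum_(j < n) a j *: model al be j =
  (\sum_(j < n) a j) *: (al *: b 0) + \sum_(j < n) a j *: (be *: b j.+1).
Proof.
rewrite scaler_suml -big_split; apply: eq_bigr => j _.
by rewrite scalerDr.
Qed.

Lemma disjoint_basis (c : R) (i j k : nat) : i != j ->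
  (c *: b i) k = 0 \/ (c *: b j) k = 0.
Proof.
move=> ij; rewrite !ellZ !ell_basisE; have [->|_] := eqVneq k i.
  by right; rewrite (negPf ij) mulr0.
by left; rewrite mulr0.
Qed.

Lemma model_norm al be n (a : nat -> R) : 0 <= al -> 0 <= be ->
  `|\sum_(j < n) a j *: model al be j| `^ p =
  al `^ p * `|\sum_(j < n) a j| `^ p + be `^ p * \sum_(j < n) `|a j| `^ p.
Proof.
move=> al0 be0; rewrite model_sum ell_norm_block_comb.
- rewrite normrZ ell_basis_norm mulr1 ger0_norm// mulrC; congr (_ + _).
  rewrite mulr_sumr; apply: eq_bigr => j _.
  by rewrite normrZ ell_basis_norm mulr1 ger0_norm// mulrC.
- move=> j k; rewrite !ellZ !ell_basisE; have [->|_] := eqVneq k 0%N.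
    by right; rewrite mulr0.
  by left; rewrite mulr0.
- by move=> i j k ij; exact: disjoint_basis.
Qed.

Lemma shifted_basis_norm be n (a : nat -> R) : 0 <= be ->
  `|\sum_(j < n) a j *: (be *: b j.+1)| `^ p = be `^ p * \sum_(j < n) `|a j| `^ p.
Proof.
move=> be0; have := model_norm n a (lexx _) be0.
by rewrite model_sum scale0r scaler0 add0r powR0 ?gt_eqF// mul0r add0r.
Qed.

Lemma basis_norm n (a : nat -> R) :
  `|\sum_(j < n) a j *: b j| `^ p = \sum_(j < n) `|a j| `^ p.
Proof.
have := @ell_norm_block_comb _ _ hp n 0 (fun j : 'I_n => b j) 0 (fun j => a j).
rewrite scaler0 add0r => ->.
- rewrite normr0 powR0 ?gt_eqF// mul0r add0r; apply: eq_bigr => j _.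
  by rewrite ell_basis_norm powR1 mulr1.
- by left.
- by move=> i j k ij; have := @disjoint_basis 1 i j k ij; rewrite !scale1r.
Qed.

End ell_basis_theory.

(** * Consequences of the norm formula, and the case p > 1 *)

Section models.
Context (R : realType) (p : R) (hp : 1 <= p).
Context (V : lmodType R) (nu : seminorm V) (e : nat -> V) (al be : R).
Let p_gt0 : 0 < p := lt_le_trans ltr01 hp.
Local Notation b := (ell_basis hp).
Hypothesis he : hamel_basis e.
Hypothesis al0 : 0 <= al.
Hypothesis be0 : 0 <= be.
Hypothesis form : forall n (a : nat -> R), nu (\sum_(j < n) a j *: e j) `^ p =
  al `^ p * `|\sum_(j < n) a j| `^ p + be `^ p * \sum_(j < n) `|a j| `^ p.
Let u j := completion_in nu (e j).
Let v := model hp al be.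

Lemma model_isometric n (a : nat -> R) :
  nu (\sum_(j < n) a j *: e j) = `|\sum_(j < n) a j *: v j|.
Proof.
apply: (powR_injective p_gt0); rewrite ?nnegrE ?seminorm_ge0//.
by rewrite form model_norm.
Qed.

Lemma lincomb_isometric c : `|lincomb u c| = `|lincomb v c|.
Proof. by rewrite /lincomb completion_in_sum completion_in_norm model_isometric. Qed.

Lemma linked_sum n (a : nat -> R) :
  linked u v (\sum_(0 <= j < n) a j *: u j) (\sum_(0 <= j < n) a j *: v j).
Proof. by rewrite !big_mkord -!lincomb_poly; exact: linked_lincomb. Qed.

Lemma model_coord n (a : nat -> R) j : (j < n)%N ->
  (\sum_(0 <= k < n) a k *: v k) j.+1 = be * a j.
Proof.
move=> jn; rewrite big_mkord (ell_eval_sum n (fun k => a k *: v k)).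
have E k : (a k *: v k) j.+1 = (j == k)%:R * (be * a k).
  by rewrite ellZ ellD !ellZ !ell_basisE eqSS mulr0 add0r; ring.
rewrite (eq_bigr (fun k : 'I_n => (j == k)%:R * (be * a k))) => [|k _]; last exact: E.
rewrite (bigD1 (Ordinal jn))//= eqxx mul1r big1 ?addr0// => i.
by rewrite -val_eqE eq_sym /= => /negPf ->; rewrite mul0r.
Qed.

(** Coordinate [j.+1] of a partial sum of the model is constant once [n > j], and norm convergence
    forces the coordinates to converge. So coefficients of an expansion are determined by the
    limit. *)
Lemma expansion_coord (a : nat -> R) x y : linked u v x y ->
  (fun n => \sum_(0 <= k < n) a k *: u k) @ \oo --> x -> forall j, y j.+1 = be * a j.
Proof.
move=> xy ax j; apply/eqP; rewrite -subr_eq0 -normr_le0 leNgt; apply/negP => d0.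
have /cvgrPdist_lt/(_ _ d0)[N _ NP] := ax.
have := NP (maxn N j.+1) (leq_maxl _ _).
rewrite (linked_norm lincomb_isometric (linked_sub xy (linked_sum _ a))).
apply/negP; rewrite -leNgt.
have := ell_coord_le (y - \sum_(0 <= k < maxn N j.+1) a k *: v k) j.+1.
by rewrite ell_evalB model_coord ?leq_maxr.
Qed.

(** With [be = 0] the formula would give [e 0 - e 1] seminorm 0, although it is a nonzero vector of
    the span. *)
Lemma nontrivial_gt0 : nontrivial nu e -> 0 < be.
Proof.
move=> ne; rewrite lt_def be0 andbT; apply/eqP => be_0.
pose a (j : nat) : R := if j is 0%N then 1 else - 1.
have := form 2 a; rewrite be_0 powR0 ?gt_eqF// mul0r addr0.
rewrite !big_ord_recr !big_ord0 /= !add0r subrr normr0 powR0 ?gt_eqF// mulr0.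
move=> /powR_eq0_eq0 /ne E.
have {}E : \sum_(j < 2) a j *: e j = 0.
  rewrite !big_ord_recr !big_ord0 /= !add0r; apply: E.
  by exists 2%N, (fun j => a j); rewrite !big_ord_recr !big_ord0 /= !add0r.
have := he.1 2%N (fun j => a j) E ord0; rewrite /a /= => /eqP.
by rewrite oner_eq0.
Qed.

Section reflexive_case.
Hypothesis p1 : 1 < p.

(* The averages of the first n terms of the model converge to al *: b 0. *)
Lemma average_approximable : approximable v (al *: b 0).
Proof.
move=> r r0; pose q := p - 1; have q0 : 0 < q by rewrite subr_gt0.
have rp : 0 < r `^ p by rewrite powR_gt0.
(* The average of [n.+1] terms misses its limit by a vector whose norm has p-th power [be]^ p *
   n.+1%:R^-1 [^ q]; this is below [r]^ p[once]n.+1%:R [^ q] exceeds [t]. *)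
pose t := be `^ p / r `^ p + 1.
have t0 : 0 < t by rewrite ltr_wpDl// divr_ge0// ?powR_ge0// ltW.
have [n nt] : exists n, t `^ q^-1 < n.+1%:R.
  exists (Num.truncn (t `^ q^-1)).
  by rewrite truncnS_gt.
exists (\poly_(j < n.+1) n.+1%:R^-1); rewrite (lincomb_poly _ _ (fun=> n.+1%:R^-1)).
have s1 : \sum_(j < n.+1) n.+1%:R^-1 = 1 :> R.
  by rewrite sumr_const card_ord -[LHS]mulr_natr mulVf ?pnatr_eq0.
rewrite (model_sum hp al be n.+1 (fun=> n.+1%:R^-1)) s1 scale1r.
rewrite opprD addNKr normrN.
set z := \sum_(j < _) _; rewrite ltNge; apply/negP => rz.
have : r `^ p <= `|z| `^ p.
  by apply: (ge0_ler_powR (ltW p_gt0)); rewrite ?nnegrE// ltW.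
rewrite (shifted_basis_norm hp n.+1 (fun=> n.+1%:R^-1) be0 : `|z| `^ p = _).
have -> : \sum_(j < n.+1) `|n.+1%:R^-1 : R| `^ p = n.+1%:R * n.+1%:R^-1 `^ p.
  by rewrite sumr_const card_ord -[LHS]mulr_natl ger0_norm ?invr_ge0.
rewrite -(@mulr_powRB1 _ n.+1%:R^-1 p) ?invr_ge0// [n.+1%:R * (_ * _)]mulrA.
rewrite divff ?pnatr_eq0// mul1r -/q.
have tN : t < n.+1%:R `^ q.
  have -> : t = (t `^ q^-1) `^ q by rewrite -powRrM mulVf ?gt_eqF// powRr1// ltW.
  by apply: gt0_ltr_powR; rewrite ?nnegrE ?powR_ge0.
have : n.+1%:R `^ q * n.+1%:R^-1 `^ q = 1 :> R.
  by rewrite -powRM ?invr_ge0// divff ?pnatr_eq0// powR1.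
have : 0 < n.+1%:R^-1 `^ q :> R by rewrite powR_gt0// invr_gt0.
have : be `^ p = (t - 1) * r `^ p by rewrite /t addrK divfK// gt_eqF.
move: (r `^ p) rp (n.+1%:R `^ q) tN (n.+1%:R^-1 `^ q) (be `^ p).
move=> rp rp0 Nq tN s _ -> s0 E; apply/negP; rewrite -ltNge.
have : t * s < 1 by rewrite -E ltr_pM2r.
move=> ts; have : (t - 1) * s < 1 by rewrite mulrBl mul1r; lra.
by move=> h; rewrite mulrAC -[ltRHS]mul1r ltr_pM2r.
Qed.

Lemma approximable_model k : 0 < be -> approximable v (b k.+1).
Proof.
move=> be_gt0; have -> : b k.+1 = be^-1 *: (v k - al *: b 0).
  by rewrite addrAC subrr add0r scalerA mulVf ?scale1r// gt_eqF.
apply: approximableZ; apply: approximableB; last exact: average_approximable.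
exact: approximable_elt.
Qed.

Lemma completion_isometric_ell : 0 < be -> isometric_spaces (completion nu) (ell hp).
Proof.
(* For [al = 0] the span of the model misses [b 0], so the unshifted multiples of the basis replace
   it. Otherwise the averages supply [b 0], and subtracting it yields the other basis vectors. *)
move=> be_gt0; have [al_0|al_neq0] := eqVneq al 0.
  apply: (completion_isometric (v := fun j => be *: b j) he) => [n a|].
    apply: (powR_injective p_gt0); rewrite ?nnegrE ?seminorm_ge0//.
    rewrite form al_0 powR0 ?gt_eqF// mul0r add0r.
    under [in RHS]eq_bigr do rewrite scalerA mulrC -scalerA.
    rewrite -scaler_sumr normrZ powRM// basis_norm ger0_norm//.
  apply: ell_approximable => k; have -> : b k = be^-1 *: (be *: b k).
    by rewrite scalerA mulVf ?scale1r// gt_eqF.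
  by apply: approximableZ; exact: (approximable_elt (fun j => be *: b j)).
apply: (completion_isometric (v := v) he); first exact: model_isometric.
apply: ell_approximable => -[|k]; last exact: approximable_model.
have -> : b 0 = al^-1 *: (al *: b 0) by rewrite scalerA mulVf ?scale1r.
by apply: approximableZ; exact: average_approximable.
Qed.

Lemma schauder_isometric_ell : 0 < be -> normalized nu e -> schauder_basic nu e ->
  isometric_sequences nu Num.norm e b.
Proof.
move=> be_gt0 ne se.
have al_0 : al = 0.
  (* The limit of the averages has only coordinate 0, so by [expansion_coord] its expansion has zero
     coefficients and it would vanish; but its norm is [al]. *)
  apply/eqP; apply: contraT => al_neq0.
  have vu c : `|lincomb v c| = `|lincomb u c| by rewrite lincomb_isometric.
  have [x /linked_sym xy] := linked_ex vu average_approximable.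
  have [a [ax _]] := se x.
  have a0 j : a j = 0.
    have /eqP := expansion_coord xy ax j.
    by rewrite ellZ ell_basisE mulr0 eq_sym mulf_eq0 gt_eqF//= => /eqP.
  have x0 : x = 0.
    move: ax; rewrite (_ : (fun n => _) = (fun=> 0)); last first.
      by apply/funext => n; rewrite big1// => k _; rewrite a0 scale0r.
    by move=> /(cvg_unique (@norm_hausdorff _ _)); apply; exact: cvg_cst.
  have := linked_norm lincomb_isometric xy.
  rewrite x0 normr0 normrZ ell_basis_norm mulr1 => /esym/normr0_eq0/eqP.
  by rewrite (negPf al_neq0).
have be1 : be `^ p = 1.
  have := form 1 (fun=> 1); rewrite !big_ord1 scale1r ne normr1 powR1 !mulr1 al_0.
  by rewrite powR0 ?gt_eqF// add0r => ->.
move=> n a; have [a' aE] := ord_funE 0 a.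
apply: (powR_injective p_gt0); rewrite ?nnegrE ?seminorm_ge0//.
rewrite (eq_bigr (fun j : 'I_n => a' j *: e j)); last by move=> j _; rewrite aE.
rewrite [in RHS](eq_bigr (fun j : 'I_n => a' j *: b j)); last by move=> j _; rewrite aE.
by rewrite form al_0 be1 basis_norm powR0 ?gt_eqF// mul0r add0r mul1r.
Qed.

End reflexive_case.
End models.


(** * The case p = 1 *)

Section ell1.
Context (R : realType) (V : lmodType R) (nu : seminorm V) (e : nat -> V) (al be : R).
Local Notation hp := (lexx (1 : R)).
Local Notation b := (ell_basis hp).
Hypothesis he : hamel_basis e.
Hypothesis al0 : 0 <= al.
Hypothesis be0 : 0 < be.
Hypothesis form : forall n (a : nat -> R), nu (\sum_(j < n) a j *: e j) `^ 1 =
  al `^ 1 * `|\sum_(j < n) a j| `^ 1 + be `^ 1 * \sum_(j < n) `|a j| `^ 1.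
Let u j := completion_in nu (e j).
Let v := model hp al be.
Let uv := lincomb_isometric hp al0 (ltW be0) form.

Lemma ell1_form n (a : nat -> R) : nu (\sum_(j < n) a j *: e j) =
  al * `|\sum_(j < n) a j| + be * \sum_(j < n) `|a j|.
Proof.
rewrite -[LHS]powRr1 ?seminorm_ge0// form !powRr1// ?(ltW be0)//.
by congr (_ + _ * _); apply: eq_bigr => j _; rewrite powRr1.
Qed.

Lemma ell1_basis_norm n (a : nat -> R) :
  `|\sum_(j < n) a j *: b j| = \sum_(j < n) `|a j|.
Proof.
rewrite -[LHS]powRr1// basis_norm.
by under eq_bigr do rewrite powRr1//.
Qed.

Lemma ell1_equivalent : equivalent_sequences nu Num.norm e b.
Proof.
exists be, (al + be); split=> //; first by rewrite ltr_wpDl.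
move=> n a; have [a' aE] := ord_funE 0 a.
rewrite (eq_bigr (fun j : 'I_n => a' j *: e j)); last by move=> j _; rewrite aE.
rewrite (eq_bigr (fun j : 'I_n => a' j *: b j)); last by move=> j _; rewrite aE.
rewrite ell1_form ell1_basis_norm; split; first by rewrite lerDr mulr_ge0.
by rewrite mulrDl lerD2r ler_wpM2l// ler_norm_sum.
Qed.

Lemma ell1_sum_le (y : ell hp) n : \sum_(j < n) `|y j.+1| <= `|y|.
Proof.
have := ell_sum_le y n.+1; rewrite powRr1 ?ell_norm_ge0// big_mkord.
under eq_bigr do rewrite powRr1//.
by rewrite big_ord_recl/=; apply: le_trans; rewrite lerDr.
Qed.

(** For [p = 1] the coordinates [j.+1] alone control the norm of a combination of the model, up to
    the factor [(al + be) / be]. Hence partial sums with the coefficients read off these coordinates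
    approximate as well as any finite combination, up to a constant. *)
Lemma ell1_schauder : schauder_basic nu e.
Proof.
move=> x; have [y xy] := linked_ex uv (completion_approximable x he).
pose a j := y j.+1 / be; exists a; split; last first.
  move=> a' xa'; apply/funext => j.
  rewrite /a (expansion_coord al0 (ltW be0) form xy xa').
  by rewrite mulrC mulKf// gt_eqF.
apply/cvgrPdist_lt => r r0.
(* The final error is [|z|] for the approximation by [c], plus [(al + be) / be * |z|] for passing
   from [c] to [a]. *)
have d0 : 0 < r / (1 + (al + be) / be).
  by rewrite divr_gt0// ltr_wpDr// divr_ge0 ?addr_ge0// ltW.
have [c [_ yc]] := xy _ d0.
exists (size c) => // n /= cn.
rewrite (linked_norm uv (linked_sub xy (linked_sum hp nu e al be n a))).
set z := y - lincomb v c in yc.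
have zn : be * \sum_(j < n) `|c`_j - a j| <= `|z|.
  apply: le_trans (ell1_sum_le z n); rewrite mulr_sumr; apply: ler_sum => j _.
  rewrite -{1}(gtr0_norm be0) -normrM -normrN /z ell_evalB.
  have -> : lincomb v c j.+1 = be * c`_j.
    rewrite (@lincomb_widen _ _ _ _ (maxn n (size c))) ?leq_maxr//.
    rewrite -(big_mkord xpredT (fun k => c`_k *: v k)) model_coord//.
    by rewrite (leq_trans (ltn_ord j))// leq_maxl.
  by rewrite /a mulrBr [be * (_ / _)]mulrC divfK ?gt_eqF// opprB.
have dn : `|lincomb v c - \sum_(0 <= k < n) a k *: v k| <= (al + be) / be * `|z|.
  rewrite big_mkord (lincomb_widen _ cn) -sumrB.
  under eq_bigr do rewrite -scalerBl.
  rewrite -(model_isometric hp al0 (ltW be0) form n (fun j => c`_j - a j)).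
  rewrite (ell1_form n (fun j => c`_j - a j)).
  apply: le_trans (_ : (al + be) * \sum_(j < n) `|c`_j - a j| <= _).
    by rewrite mulrDl lerD2r ler_wpM2l// ler_norm_sum.
  by rewrite -mulrA ler_wpM2l ?addr_ge0 ?(ltW be0)// mulrC ler_pdivlMr// mulrC.
apply: le_lt_trans (ler_distD (lincomb v c) _ _) _.
move: yc; rewrite ltr_pdivlMr; last first.
  by rewrite ltr_wpDr// divr_ge0 ?addr_ge0// ltW.
by apply: le_lt_trans; rewrite mulrDr mulr1 lerD2l mulrC.
Qed.

End ell1.

(** * From the norm formula to the three statements *)

Lemma spreading_model_of_order_formula (R : realType) (p : R) (hp : 1 <= p)
    (V : lmodType R) (nu : seminorm V) (e : nat -> V) (xi : cord) :
  cord_le cord1 xi -> spreading_model_of_order xi (ell hp) nu e ->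
  hamel_basis e /\ exists al be : R, [/\ 0 <= al, 0 <= be &
    forall n (a : nat -> R), nu (\sum_(j < n) a j *: e j) `^ p =
      al `^ p * `|\sum_(j < n) a j| `^ p + be `^ p * \sum_(j < n) `|a j| `^ p].
Proof.
move=> xi1 [he [F [[thF [_ spF _]] oF [M [x [Mh gen]]]]]]; split=> //.
have nF0 := order_ge1_fset0 thF xi1 oF; have [F0 [rk [Frk _]]] := oF.
have [A [B [A0 B0 AB]]] := spreading_model_formula Mh thF spF (tree_lt_wf Frk) F0 nF0 gen.
have p0 : p != 0 by rewrite gt_eqF// (lt_le_trans ltr01).
exists (A `^ p^-1), (B `^ p^-1); split; rewrite ?powR_ge0// => n a.
by rewrite -!powRrM !mulVf// !powRr1.
Qed.

Theorem theorem0p17 (R : realType) :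
  (forall (p : R) (p1 : 1 < p)
      (V : lmodType R) (nu : seminorm V) (e : nat -> V) (xi : cord),
    cord_le cord1 xi ->
    spreading_model_of_order xi (ell (ltW p1)) nu e ->
    nontrivial nu e ->
    (normalized nu e -> schauder_basic nu e ->
       isometric_sequences nu Num.norm e (ell_basis (ltW p1))) /\
    (singular nu e -> isometric_spaces (completion nu) (ell (ltW p1)))) /\
  (forall (V : lmodType R) (nu : seminorm V) (e : nat -> V) (xi : cord),
    cord_le cord1 xi ->
    spreading_model_of_order xi (ell (lexx (1 : R))) nu e ->
    nontrivial nu e ->
    schauder_basic nu e /\
    equivalent_sequences nu Num.norm e (ell_basis (lexx (1 : R)))) /\
  (forall (p : R) (p1 : 1 <= p)
      (V : lmodType R) (nu : seminorm V) (e : nat -> V),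
    spreading_model (ell p1) nu e ->
    exists u : nat -> ell p1, isometric_sequences nu Num.norm e u).
Proof.
split; [|split].
- move=> p p1 V nu e xi xi1 sm ne.
  have [he [al [be [al0 be0 form]]]] := spreading_model_of_order_formula xi1 sm.
  have be_gt0 := nontrivial_gt0 (ltW p1) he be0 form ne.
  split=> [nn sn|_]; first exact: schauder_isometric_ell form _ _ _ _.
  exact: completion_isometric_ell form _ _.
- move=> V nu e xi xi1 sm ne.
  have [he [al [be [al0 be0 form]]]] := spreading_model_of_order_formula xi1 sm.
  have be_gt0 := nontrivial_gt0 (lexx 1) he be0 form ne.
  split; first exact: ell1_schauder form.
  exact: ell1_equivalent form.
- move=> p p1 V nu e [xi [xi1 sm]].
  have [he [al [be [al0 be0 form]]]] := spreading_model_of_order_formula xi1 sm.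
  exists (model p1 al be) => n a; have [a' aE] := ord_funE 0 a.
  rewrite (eq_bigr (fun j : 'I_n => a' j *: e j)); last by move=> j _; rewrite aE.
  rewrite [in RHS](eq_bigr (fun j : 'I_n => a' j *: model p1 al be j)); last first.
    by move=> j _; rewrite aE.
  exact: model_isometric form _ _.
Qed.
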